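(* Let $\Lambda$ be a sub-semigroup of $(\mathbb{R},+)$ (with $0\in\Lambda$), and let $\mathrm{AP}_\Lambda=\{f\in \mathrm{AP}: \sigma(f)\subseteq \Lambda\}$ be the Banach algebra (supremum norm, pointwise operations) of almost periodic functions on $\mathbb{R}$ with Bohr spectrum in $\Lambda$. If the $\mathbb{Q}$-vector space $[\Lambda]\subseteq\mathbb{R}$ generated by $\Lambda$ over $\mathbb{Q}$ has infinite dimension, then $\operatorname{bsr}\mathrm{AP}_\Lambda=\infty$ and $\operatorname{tsr}\mathrm{AP}_\Lambda=\infty$.
   Context: $\mathrm{AP}$ is the uniform closure, in the algebra $C_b(\mathbb{R},\mathbb{C})$ of bounded continuous functions with the supremum norm, of the set of generalized trigonometric polynomials $Q(t)=\sum_{j=1}^N a_j e^{i\lambda_j t}$ with $a_j\in\mathbb{C}$, $\lambda_j\in\mathbb{R}$, $N\ge 1$. For $f\in\mathrm{AP}$ and $\lambda\in\mathbb{R}$, the Fourier-Bohr coefficient is $\widehat f(\lambda)=\lim_{|I|\to\infty}\frac{1}{|I|}\int_I f(t)e^{-i\lambda t}\,dt$, with $I$ running through the compact intervals of $\mathbb{R}$ (the limit exists). The Bohr spectrum is $\sigma(f)=\{\lambda\in\mathbb{R}:\widehat f(\lambda)\neq 0\}$. A sub-semigroup $\Lambda$ of $(\mathbb{R},+)$ is a subset with $0\in\Lambda$ and $\lambda+\mu\in\Lambda$ whenever $\lambda,\mu\in\Lambda$. For a commutative unital ring $A$, an $n$-tuple $(f_1,\dots,f_n)\in A^n$ is invertible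 if there is $(x_1,\dots,x_n)\in A^n$ with $\sum_{j=1}^n x_jf_j=1$; $U_n(A)$ is the set of invertible $n$-tuples. A tuple $(f_1,\dots,f_n,g)\in U_{n+1}(A)$ is reducible if there is $(a_1,\dots,a_n)\in A^n$ with $(f_1+a_1g,\dots,f_n+a_ng)\in U_n(A)$. The Bass stable rank $\operatorname{bsr}A$ is the smallest integer $n\ge1$ such that every element of $U_{n+1}(A)$ is reducible, and $\operatorname{bsr}A=\infty$ if no such $n$ exists. For a commutative unital Banach algebra $A$, the topological stable rank $\operatorname{tsr}A$ is the least integer $n\ge1$ such that $U_n(A)$ is dense in $A^n$, and $\operatorname{tsr}A=\infty$ if no such $n$ exists. *)

(* Defs.v *)
From HB Require Import structures.
From mathcomp Require Import all_boot all_order all_algebra.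
From mathcomp Require Import all_classical all_reals all_analysis.
From mathcomp Require Import complex.

Set Implicit Arguments.
Unset Strict Implicit.
Unset Printing Implicit Defensive.

Import Order.TTheory GRing.Theory Num.Theory.
Import numFieldNormedType.Exports.

Local Open Scope classical_set_scope.
Local Open Scope ring_scope.
Local Open Scope complex_scope.

(* A commutative ring is presented by its carrier [A], a subset of an ambient
   commutative ring [B] closed under the ring operations of [B]; all witnesses
   below are required to lie in [A], so nothing depends on the choice of [B]. *)
Section StableRank.
Variable B : comPzRingType.
Implicit Types (A : set B) (n : nat).

Definition tuples A n : set ('I_n -> B) := [set f | forall j, A (f j)].

Arguments tuples A n : clear implicits.

Definition invertible_tuples A n : set ('I_n -> B) :=
  [set f | tuples A n f /\
    exists2 x : 'I_n -> B, tuples A n x & \sum_(j < n) x j * f j = 1].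

Arguments invertible_tuples A n : clear implicits.

(* The tuple (f_1, ..., f_n, g) is [F], with [g] its last entry. *)
Definition reducible A n (F : 'I_n.+1 -> B) : Prop :=
  exists2 a : 'I_n -> B, tuples A n a &
    invertible_tuples A n
      (fun j => F (widen_ord (leqnSn n) j) + a j * F ord_max).

End StableRank.

Arguments tuples {B} A n.
Arguments invertible_tuples {B} A n.

Definition least_pos (P : nat -> Prop) : \bar nat :=
  if pselect (exists n, `[< (0 < n)%N /\ P n >]) is left h
  then (ex_minn h)%:E else +oo%E.

Definition bsr (B : comPzRingType) (A : set B) : \bar nat :=
  least_pos (fun n => invertible_tuples A n.+1 `<=` @reducible B A n).

Section AlmostPeriodic.
Variable R : realType.
Implicit Types (f Q : R -> R[i]) (t lambda : R) (Lambda : set R).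

Definition supnorm f : \bar R :=
  ereal_sup (range (fun t => (Normc.normc (f t))%:E)).

(* [A] is an algebra of bounded functions, normed by the sup norm. *)
Definition tsr (A : set (R -> R[i])) : \bar nat :=
  least_pos (fun n => forall F, tuples A n F -> forall e : R, 0 < e ->
    exists2 G, invertible_tuples A n G &
      forall j, (supnorm (F j - G j)%R < e%:E)%E).

Definition Cb : set (R -> R[i]) :=
  [set f | continuous (f : R -> R[i]^o) /\ (supnorm f < +oo)%E].

Definition expi t : R[i] := cos t +i* sin t.

Definition trig_poly : set (R -> R[i]) :=
  [set Q | exists N (a : 'I_N -> R[i]) (lambda : 'I_N -> R),
    (0 < N)%N /\ forall t, Q t = \sum_(j < N) a j * expi (lambda j * t)].

Definition AP : set (R -> R[i]) :=
  [set f | Cb f /\ forall e : R, 0 < e ->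
    exists2 Q, trig_poly Q & (supnorm (f - Q)%R < e%:E)%E].

Definition cintegral (D : set R) f : R[i] :=
  (\int[lebesgue_measure]_(t in D) complex.Re (f t)) +i*
  (\int[lebesgue_measure]_(t in D) complex.Im (f t)).

(* The pair (a, b) stands for the interval [a, b]. *)
Definition mean f (I : R * R) : R[i] :=
  ((I.2 - I.1)^-1)%:C * cintegral `[I.1, I.2] f.

Definition length_to_infty : set_system (R * R) :=
  [set U | \forall L \near +oo, forall I : R * R, L <= I.2 - I.1 -> U I].

#[global] Instance length_to_infty_proper : ProperFilter length_to_infty.
Proof.
apply: Build_ProperFilter_ex => [U [L [_ /(_ (L + 1))]]|].
  rewrite ltrDl ltr01 => /(_ isT (0, L + 1)) UL; exists (0, L + 1).
  by apply: UL; rewrite /= subr0.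
apply: Build_Filter => [|U V HU HV|U V UV HU].
- by apply/nearW => L I _.
- rewrite /length_to_infty /= in HU HV *.
  by apply: filterS2 HU HV => L HU HV I LI; split; [exact: HU|exact: HV].
- rewrite /length_to_infty /= in HU *.
  by apply: filterS HU => L HU I /HU /UV.
Qed.

(* [lim] is total; the limit exists for [f] in [AP]. *)
Definition bohr_coef f lambda : R[i] :=
  lim ((mean (fun t => f t * expi (- (lambda * t))) I : R[i]^o)
       @[I --> length_to_infty]).

Definition bohr_spectrum f : set R := [set lambda | bohr_coef f lambda != 0].

Definition APin Lambda : set (R -> R[i]) :=
  [set f | AP f /\ bohr_spectrum f `<=` Lambda].

Definition subsemigroup Lambda : Prop :=
  Lambda 0 /\ forall x y, Lambda x -> Lambda y -> Lambda (x + y).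

Definition Qspan (S : set R) : set R :=
  [set x | exists n (q : 'I_n -> rat) (v : 'I_n -> R),
    (forall i, S (v i)) /\ x = \sum_(i < n) ratr (q i) * v i].

Definition Qfinite_dim (V : set R) : Prop :=
  exists s : seq R, V = Qspan [set` s].

End AlmostPeriodic.

(* Main.v *)
Require Import Defs.
From mathcomp Require Import all_boot all_order all_algebra all_fingroup.
From mathcomp Require Import all_classical all_reals all_analysis.
From mathcomp Require Import complex.
From mathcomp Require Import zify ring lra.

(* Rational independence provides 4n frequencies in Lambda on which additive maps
   L : R -> R can be prescribed arbitrarily.  Taking opposite values on pairs of
   frequencies, combinations of the exponentials produce 2n functions whose
   values under the characters expi (L _) are sin x_0, ..., sin x_(2n-1), for an
   arbitrary point x of R^(2n).  Put z_j = sin x_j + i sin x_(n+j), f_j = z_j and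
   g = 1 - sum_j |z_j|^2, where the conjugates of the z_j are again combinations
   of the exponentials; thus (f_1, ..., f_n, g) is invertible.  An upper bound of
   a trigonometric polynomial on the real line remains valid at all the
   characters, hence so does a lower bound of sum_j |u_j|^2.  If
   u_j = f_j + a_j g were invertible, then
   z + a max(0, 1 - |z|^2) would be a zero-free map on the cube
   [-pi/2, pi/2]^(2n) equal to z on its boundary, contradicting the
   Poincare-Miranda theorem; likewise, no tuple uniformly close to
   (f_1, ..., f_n) is invertible. *)

Set Implicit Arguments.
Unset Strict Implicit.
Unset Printing Implicit Defensive.

Import Order.TTheory GRing.Theory Num.Theory.
Import numFieldNormedType.Exports.
Import Normc.
Local Open Scope ring_scope.

(** * A discrete Poincare-Miranda theorem *)

Lemma det_col_scale (R : idomainType) n (A : 'M[R]_n) c0 c1 (a : R) :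
  c0 != c1 -> (forall j, A j c0 = a * A j c1) -> \det A = 0.
Proof.
move=> c01 Aa; rewrite -det_tr; apply/eqP/det0P.
exists (delta_mx 0 c0 - a *: delta_mx 0 c1).
  apply/eqP => /rowP/(_ c0); rewrite !mxE !eqxx (negbTE c01) /= mulr0 subr0.
  by move/eqP; rewrite oner_eq0.
apply/rowP => j; rewrite mulmxBl -scalemxAl -!rowE !mxE Aa subrr //.
Qed.

Section Grid.
Variables (R : numDomainType) (n m : nat).
Implicit Types (v : {ffun 'I_n.+1 -> 'I_m.+1}) (s : 'S_n.+1).

(* Kuhn's triangulation of the grid: the simplex (v, s) climbs from v to
   v + (1, ..., 1), the coordinate i being incremented at the step s i. *)
Definition vertex v s (k : nat) : 'I_n.+1 -> nat :=
  fun i => (v i + (s i < k)%N)%N.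

Definition facet v s (k : 'I_n.+2) : 'I_n.+1 -> 'I_n.+1 -> nat :=
  fun j => vertex v s (lift k j).

(** Exchanging the steps [k - 1] and [k] of [s] changes only the omitted vertex. The two simplices
    share this facet and have opposite signs, so the sum equals its own opposite. *)
Lemma interior_facets_cancel (w : ('I_n.+1 -> 'I_n.+1 -> nat) -> R) v
    (k : 'I_n.+2) : (0 < k < n.+1)%N ->
  \sum_s (-1) ^+ odd_perm s * w (facet v s k) = 0.
Proof.
move=> /andP[k0 kn]; apply/eqP; rewrite -eqNr; apply/eqP.
have kn' : (k.-1 < n.+1)%N by lia.
set a := Ordinal kn'; set b := Ordinal kn.
have ab : a != b by rewrite -val_eqE /=; lia.
rewrite [RHS](reindex_inj (mulIg (tperm a b))) -sumrN; apply: eq_bigr => s _.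
rewrite odd_permM odd_tperm ab addbT signrN mulNr; congr (- (_ * w _)).
apply/funext => j; apply/funext => i; rewrite /facet /vertex; congr (_ + _)%N.
have : lift k j != k :> nat by rewrite eq_sym neq_lift.
rewrite permM; move: (nat_of_ord (lift k j)) => l lk.
by case: tpermP => [->|->|//] /=; lia.
Qed.

(* Facet 0 of the simplex (v, s) is the last facet of a neighbour whose
   increments are those of s, the first one being moved to the end. *)
Definition rot_perm : 'S_n.+1 := lift_perm ord0 ord_max 1.

(** The neighbour is reached by raising the coordinate [i0] that [s] increments first and composing
    [s] with [rot_perm], of sign (-1)^n. On the faces of the grid, where there is no neighbour, [w]
    vanishes. *)
Lemma outer_facets_cancel (w : ('I_n.+1 -> 'I_n.+1 -> nat) -> R) :
  (forall f i, (forall j, f j i = 0%N) \/ (forall j, f j i = m.+1) ->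
    w f = 0) ->
  \sum_v \sum_s (-1) ^+ odd_perm s * w (facet v s ord0) =
  (-1) ^+ n * \sum_v \sum_s (-1) ^+ odd_perm s * w (facet v s ord_max).
Proof.
move=> w0; rewrite exchange_big [in RHS]exchange_big /=.
rewrite [in RHS](reindex_inj (mulIg rot_perm)) big_distrr /=.
apply: eq_bigr => s _; pose i0 := (s^-1 ord0)%g.
have si0 : s i0 = ord0 by rewrite permKV.
(* [ordS] wraps [m] around to 0, which makes the shift a bijection of the cells; where it wraps,
   both facets lie on faces of the grid and contribute 0. *)
pose shift v : {ffun 'I_n.+1 -> 'I_m.+1} :=
  [ffun i => if i == i0 then ordS (v i) else v i].
have shift_inj : injective shift.
  move=> v v' /ffunP e; apply/ffunP => i; move: (e i); rewrite !ffunE.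
  by case: ifP => // _ /ordS_inj.
rewrite [in RHS](reindex_inj shift_inj) big_distrr /=.
apply: eq_bigr => v _.
have -> : (-1) ^+ odd_perm s = (-1) ^+ n * (-1) ^+ odd_perm (s * rot_perm) :> R.
  rewrite odd_permM odd_lift_perm /= odd_perm1 addbF addbC -(signr_odd _ n).
  by rewrite -signr_addb addKb.
rewrite -mulrA; congr (_ * (_ * _)).
have := ltn_ord (v i0); rewrite ltnS leq_eqVlt => /orP[vm|vm].
  rewrite (w0 _ i0) ?(w0 _ i0) //.
    left=> j; rewrite /facet /vertex ffunE eqxx /= (eqP vm) modnn permM si0.
    by rewrite lift_perm_id /=; have := ltn_ord j; rewrite /bump; lia.
  by right=> j; rewrite /facet /vertex si0 /= (eqP vm) /bump; lia.
congr (w _); apply/funext => j; apply/funext => i; rewrite /facet /vertex ffunE.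
case: eqVneq => [->|ii0].
  rewrite permM si0 lift_perm_id /= modn_small //.
  by have := ltn_ord j; rewrite /bump; lia.
have : s i != ord0 by rewrite -si0 (inj_eq perm_inj).
rewrite permM; case: (unliftP ord0 (s i)) => [l ->|->]; last by rewrite eqxx.
move=> _; rewrite lift_perm_lift perm1 /=; congr (_ + _)%N.
by have := ltn_ord j; have := ltn_ord l; rewrite /bump; lia.
Qed.

(** A discrete Stokes formula: after the cancellations within the cells only the facets 0 and [n.+1]
    remain, with signs 1 and (-1)^(n+1), and these cancel between neighbouring cells. *)
Lemma alternating_facet_sum (w : ('I_n.+1 -> 'I_n.+1 -> nat) -> R) :
  (forall f i, (forall j, f j i = 0%N) \/ (forall j, f j i = m.+1) ->
    w f = 0) ->
  \sum_v \sum_s (-1) ^+ odd_perm s *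
    (\sum_(k < n.+2) (-1) ^+ k * w (facet v s k)) = 0.
Proof.
move=> w0.
transitivity (\sum_(k < n.+2) (-1) ^+ k *
    \sum_v \sum_s (-1) ^+ odd_perm s * w (facet v s k)).
  under [RHS]eq_bigr => k _ do rewrite mulr_sumr.
  rewrite [RHS]exchange_big; apply: eq_bigr => v _ /=.
  under [RHS]eq_bigr => k _ do rewrite mulr_sumr.
  rewrite [RHS]exchange_big; apply: eq_bigr => s _ /=.
  by rewrite mulr_sumr; apply: eq_bigr => k _; rewrite mulrCA.
rewrite big_ord_recl big_ord_recr /= [X in _ + (X + _)]big1 ?add0r => [|k _]; last first.
  rewrite big1 ?mulr0 // => v _; apply: interior_facets_cancel.
  by rewrite /= /bump; have := ltn_ord k; lia.
rewrite expr0 mul1r outer_facets_cancel //.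
have -> : lift ord0 ord_max = ord_max :> 'I_n.+2 by apply/val_inj.
by rewrite exprS -mulrDl mulN1r subrr mul0r.
Qed.

Definition simplex_mx (h : 'I_n.+1 -> ('I_n.+1 -> nat) -> R) v s : 'M[R]_n.+2 :=
  \matrix_(k, c) if unlift ord0 c is Some i then h i (vertex v s k) else 1.

(* n.+1`! times the signed volume of the image of the piecewise affine map
   interpolating h. *)
Definition grid_degree h :=
  \sum_v \sum_s (-1) ^+ odd_perm s * \det (simplex_mx h v s).

Definition boundary_const (h : 'I_n.+1 -> ('I_n.+1 -> nat) -> R) l :=
  forall x y, x l = y l -> x l = 0%N \/ x l = m.+1 -> h l x = h l y.

Lemma grid_degree_eq0 h i :
  (forall l, l != i -> boundary_const h l) ->
  (forall x, x i = 0%N \/ x i = m.+1 -> h i x = 0) ->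
  grid_degree h = 0.
Proof.
move=> hc hi.
pose ci := lift ord0 i.
(* Column i may be replaced by its difference with a constant, a combination of
   column 0; the constant being the sum of h i over all the vertices, the
   cofactor expansion becomes an alternating sum over the facets. *)
pose w (f : 'I_n.+1 -> 'I_n.+1 -> nat) : R := (\sum_j h i (f j)) *
  \det (\matrix_(j < n.+1, c < n.+1)
    if unlift ord0 (lift ci c) is Some l then h l (f j) else 1).
have detw v s : \det (simplex_mx h v s) =
    - (-1) ^+ ci * \sum_(k < n.+2) (-1) ^+ k * w (facet v s k).
  set A := simplex_mx h v s.
  have detA : \det A = \sum_(k < n.+2) h i (vertex v s k) * cofactor A k ci.
    rewrite (expand_det_col _ ci); apply: eq_bigr => k _.
    by rewrite mxE /ci liftK.
  have cof0 : \sum_(k < n.+2) cofactor A k ci = 0.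
    pose B : 'M[R]_n.+2 := \matrix_(k, c) if c == ci then 1 else A k c.
    have : \det B = 0.
      apply: (@det_col_scale _ _ _ ci ord0 1) => // j.
      by rewrite !mxE eqxx unlift_none mulr1.
    rewrite (expand_det_col _ ci) => B0; rewrite -[RHS]B0; apply: eq_bigr => k _.
    rewrite mxE eqxx mul1r /cofactor; congr (_ * \det _).
    by apply/matrixP => a b; rewrite !mxE eq_sym (negbTE (neq_lift _ _)).
  pose S := \sum_(k < n.+2) h i (vertex v s k).
  have {detA} -> : \det A = \sum_(k < n.+2) (h i (vertex v s k) - S) * cofactor A k ci.
    under eq_bigr => k _ do rewrite mulrBl.
    by rewrite sumrB -mulr_sumr cof0 mulr0 subr0.
  rewrite big_distrr /=; apply: eq_bigr => k _.
  rewrite /S (bigD1_ord k) //= /w /cofactor exprD.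
  set X := \det _; set Y := \det _.
  have -> : X = Y.
    congr (\det _); apply/matrixP => a b; rewrite !mxE.
    by [].
  rewrite opprD addrA subrr add0r !mulNr; congr (- _).
  set T := \sum_(_ < _) _.
  rewrite -[bump 0 i]/(nat_of_ord ci).
  move: T Y ((-1) ^+ k) ((-1) ^+ ci) => T Y e e'. ring.
rewrite /grid_degree.
under eq_bigr => v _ do under eq_bigr => s _ do rewrite detw mulrCA.
under eq_bigr => v _ do rewrite -mulr_sumr.
rewrite -mulr_sumr alternating_facet_sum ?mulr0 // => f l fl.
(* For a facet inside a face orthogonal to [l]: if [l] is [i], the sum of the values of [h i]
   vanishes; otherwise the column of [h l] is a multiple of the column of ones. *)
rewrite /w; case: (eqVneq l i) => [li|li].
  rewrite big1 ?mul0r // => j _; apply: hi; rewrite -li.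
  by case: fl => fl; [left|right].
have [c1 c1E _] : {c1 | ord0 = lift ci c1 & unlift ci ord0 = Some c1}.
  by apply: unlift_some; rewrite eq_sym neq_lift.
have [c0 c0E _] : {c0 | lift ord0 l = lift ci c0 & unlift ci (lift ord0 l) = Some c0}.
  by apply: unlift_some; rewrite (inj_eq lift_inj) eq_sym.
rewrite (@det_col_scale _ _ _ c0 c1 (h l (f ord0))) ?mulr0 //.
  by apply/eqP => cc; have := c0E; rewrite cc -c1E => /(congr1 val).
move=> j; rewrite !mxE -c0E -c1E liftK unlift_none mulr1.
by apply: hc => //; case: fl => fl; rewrite !fl //; [left|right].
Qed.


(** The coordinates are replaced one at a time. By multilinearity of the determinant, each
    replacement changes the degree by that of a map whose new coordinate [h' l - h l] vanishes on
    its two faces, which is 0 by [grid_degree_eq0]. *)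
Lemma grid_degree_homotopy h h' :
  (forall l, boundary_const h l) ->
  (forall l x, x l = 0%N \/ x l = m.+1 -> h' l x = h l x) ->
  grid_degree h = grid_degree h'.
Proof.
move=> hc hh'.
pose g r : 'I_n.+1 -> ('I_n.+1 -> nat) -> R := fun l x =>
  if (l < r)%N then h' l x else h l x.
have gc r l : boundary_const (g r) l.
  move=> x y xy x0; rewrite /g; case: ifP => _; last exact: hc.
  by rewrite !hh' -?xy //; exact: hc.
suff gr r : (r <= n.+1)%N -> grid_degree (g r) = grid_degree h.
  have <- : g n.+1 = h' by apply/funext => l; rewrite /g ltn_ord.
  by rewrite gr.
elim: r => [|r IH rn]; first by [].
rewrite -(IH (ltnW rn)); apply/eqP; rewrite -subr_eq0.
pose i := Ordinal rn.
pose d : 'I_n.+1 -> ('I_n.+1 -> nat) -> R := fun l x =>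
  if l == i then h' l x - h l x else g r l x.
have <- : grid_degree d = grid_degree (g r.+1) - grid_degree (g r).
  rewrite /grid_degree -sumrB; apply: eq_bigr => v _.
  rewrite -sumrB; apply: eq_bigr => s _; rewrite -mulrBr; congr (_ * _).
  rewrite -!(det_tr (simplex_mx _ _ _)) -[RHS]addrC -mulN1r.
  rewrite -[X in _ + X]mul1r; apply: (determinant_multilinear (i0 := lift ord0 i)).
  - apply/rowP => k; rewrite !mxE liftK /d /g eqxx /= ltnSn ltnn mulN1r mul1r.
    by rewrite addrC.
  - apply/matrixP => c k; rewrite !mxE; case: (unliftP ord0 _) => // l lE.
    rewrite /d /g; case: eqVneq => [li|li].
      by have := neq_lift (lift ord0 i) c; rewrite lE li eqxx.
    by [].
  - apply/matrixP => c k; rewrite !mxE; case: (unliftP ord0 _) => // l lE.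
    rewrite /d /g; case: eqVneq => [li|li].
      by have := neq_lift (lift ord0 i) c; rewrite lE li eqxx.
    by rewrite ltnS leq_eqVlt -val_eqE /= in li *; rewrite (negbTE li).
apply/eqP/(@grid_degree_eq0 _ i).
  move=> l li x y xy x0; rewrite /d (negbTE li); exact: gc.
by move=> x xi; rewrite /d eqxx hh' // subrr.
Qed.

(** Away from the origin cell some coordinate is constantly 1 on the cell, repeating the column of
    ones. In the origin cell each matrix is unitriangular up to a permutation of columns of the same
    sign as [s], so each [s] contributes 1. *)
Lemma grid_degree_step : grid_degree (fun l x => (0 < x l)%N%:R) = n.+1`!%:R.
Proof.
have det_step v s : v != [ffun => ord0] ->
    \det (simplex_mx (fun l x => (0 < x l)%N%:R) v s) = 0.
  move=> v0; have [i vi] : exists i, v i != ord0.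
    apply/existsP; apply: contraNT v0 => /existsPn vi; apply/eqP/ffunP => i.
    by rewrite ffunE; apply/eqP; have := vi i; rewrite negbK.
  apply: (@det_col_scale _ _ _ (lift ord0 i) ord0 1) => // k.
  rewrite !mxE liftK unlift_none mulr1 /vertex addn_gt0.
  by rewrite -(inj_eq val_inj) /= -lt0n in vi; rewrite vi.
rewrite /grid_degree (bigD1 [ffun => ord0]) //= [X in _ + X]big1 ?addr0; last first.
  by move=> v v0; rewrite big1 // => s _; rewrite det_step ?mulr0.
under eq_bigr => s _.
  pose L : 'M[R]_n.+2 := \matrix_(k, c) (c <= k)%N%:R.
  have -> : simplex_mx (fun l x => (0 < x l)%N%:R) [ffun => ord0] s =
      col_perm (lift_perm ord0 ord0 s) L.
    apply/matrixP => k c; rewrite !mxE; case: (unliftP ord0 c) => [l ->|->].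
      rewrite lift_perm_lift /vertex ffunE add0n lt0n eqb0 negbK //.
    by rewrite lift_perm_id.
  have -> : \det (col_perm (lift_perm ord0 ord0 s) L) = (-1) ^+ odd_perm s.
    rewrite col_permE det_mulmx det_perm odd_permV odd_lift_perm /= .
    rewrite det_trig ?mul1r.
      by rewrite big1 ?mul1r // => i _; rewrite mxE leqnn.
    by apply/is_trig_mxP => i j ij; rewrite mxE leqNgt ij.
  rewrite -signr_addb addbb expr0.
  over.
by rewrite sumr_const card_Sn.
Qed.

End Grid.

(** Comparison with the step map shows that the degree of the 0-1 map is nonzero, so some simplex
    has nonzero determinant. There no [h i] is constant on the vertices, since its column would be a
    multiple of the column of ones. *)
Lemma discrete_poincare_miranda n m (h : 'I_n.+1 -> ('I_n.+1 -> nat) -> bool) :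
  (forall i x, x i = 0%N -> ~~ h i x) -> (forall i x, x i = m.+1 -> h i x) ->
  exists v : {ffun 'I_n.+1 -> 'I_m.+1}, forall i, exists x y,
    [/\ h i x, ~~ h i y, forall l, (v l <= x l <= v l + 1)%N &
        forall l, (v l <= y l <= v l + 1)%N].
Proof.
move=> h0 h1; pose H i x : int := (h i x)%:R.
have degH : @grid_degree int n m H != 0.
  rewrite (@grid_degree_homotopy int n m H (fun l x => (0 < x l)%N%:R)).
  - by rewrite grid_degree_step pnatr_eq0 -lt0n fact_gt0.
  - move=> l x y xy [] xl; rewrite /H.
      by rewrite !(negbTE (h0 _ _ _)) // -xy.
    by rewrite !h1 // -xy.
  - by move=> l x [] xl; rewrite /H xl /= ?(h1 _ _ xl) // (negbTE (h0 _ _ xl)).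
have [v [s dvs]] : exists (v : {ffun 'I_n.+1 -> 'I_m.+1}) s, \det (simplex_mx H v s) != 0.
  apply: contrapT => nvs; move/eqP: degH; apply; rewrite /grid_degree.
  rewrite big1 // => v _; rewrite big1 // => s _.
  have [->|e] := eqVneq (\det (simplex_mx H v s)) 0; first by rewrite mulr0.
  by case: nvs; exists v, s.
have vtx k l : (v l <= vertex v s k l <= v l + 1)%N.
  by rewrite /vertex; case: (_ < _)%N; lia.
exists v => i; have Hi b : exists k : 'I_n.+2, h i (vertex v s k) = b.
  apply: contrapT => nk; move/eqP: dvs; apply.
  apply: (@det_col_scale _ _ _ (lift ord0 i) ord0 (~~ b)%:R) => // k.
  rewrite !mxE liftK unlift_none mulr1 /H; congr (nat_of_bool _)%:R.
  have : h i (vertex v s k) <> b by move=> e; apply: nk; exists k.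
  by case: (b); case: (h _ _).
have [k hk] := Hi true; have [k' hk'] := Hi false.
by exists (vertex v s k), (vertex v s k'); rewrite hk hk'.
Qed.


Local Open Scope classical_set_scope.
Local Open Scope ring_scope.
Local Open Scope complex_scope.

(** * Trigonometric polynomials and characters *)

Section Normc.
Variable R : realType.
Implicit Types z w : R[i].

Lemma normcE2 z : normc z ^+ 2 = complex.Re z ^+ 2 + complex.Im z ^+ 2.
Proof. by case: z => a b /=; rewrite sqr_sqrtr // addr_ge0 // sqr_ge0. Qed.

Lemma normc_ge0 z : 0 <= normc z.
Proof. by case: z => a b; rewrite sqrtr_ge0. Qed.

Lemma normc_triB z w : normc z <= normc (z - w) + normc w.
Proof. by rewrite -{1}(subrK w z); exact: le_normcD. Qed.

Lemma normc_sum (I : Type) (r : seq I) (P : pred I) (F : I -> R[i]) :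
  normc (\sum_(i <- r | P i) F i) <= \sum_(i <- r | P i) normc (F i).
Proof.
elim/big_ind2: _ => //; first by rewrite normc0.
by move=> z a w b za wb; apply: le_trans (le_normcD _ _) (lerD za wb).
Qed.

Lemma normcX z n : normc (z ^+ n) = normc z ^+ n.
Proof. by elim: n => [|n IH]; rewrite ?normc1 // !exprS normcM IH. Qed.

Lemma Re_le_normc z : `|complex.Re z| <= normc z.
Proof.
rewrite -[leRHS]ger0_norm ?normc_ge0 // -ler_sqr ?nnegrE // !real_normK ?num_real //.
by rewrite normcE2 lerDl sqr_ge0.
Qed.

Lemma Im_le_normc z : `|complex.Im z| <= normc z.
Proof.
rewrite -[leRHS]ger0_norm ?normc_ge0 // -ler_sqr ?nnegrE // !real_normK ?num_real //.
by rewrite normcE2 lerDr sqr_ge0.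
Qed.

Lemma normc_le_ReIm z : normc z <= `|complex.Re z| + `|complex.Im z|.
Proof.
rewrite -ler_sqr ?nnegrE ?normc_ge0 ?addr_ge0 //.
rewrite normcE2 sqrrD !real_normK ?num_real // -addrA lerD2l lerDr.
by rewrite mulrn_wge0 // mulr_ge0.
Qed.

Lemma Re_addc z w : complex.Re (z + w) = complex.Re z + complex.Re w.
Proof. by case: z; case: w. Qed.
Lemma Im_addc z w : complex.Im (z + w) = complex.Im z + complex.Im w.
Proof. by case: z; case: w. Qed.
Lemma Re_subc z w : complex.Re (z - w) = complex.Re z - complex.Re w.
Proof. by case: z; case: w. Qed.
Lemma Im_subc z w : complex.Im (z - w) = complex.Im z - complex.Im w.
Proof. by case: z; case: w. Qed.
Lemma Re_mulc z w : complex.Re (z * w) =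
  complex.Re z * complex.Re w - complex.Im z * complex.Im w.
Proof. by case: z; case: w. Qed.
Lemma Im_mulc z w : complex.Im (z * w) =
  complex.Re z * complex.Im w + complex.Im z * complex.Re w.
Proof. by case: z; case: w. Qed.

Lemma expiD (s t : R) : expi (s + t) = expi s * expi t.
Proof.
rewrite /expi; apply/eqP; rewrite eq_complex /= cosD sinD eqxx /=.
by apply/eqP; ring.
Qed.

Lemma expi0 : expi 0 = 1 :> R[i].
Proof. by rewrite /expi cos0 sin0. Qed.

Lemma normc_expi (t : R) : normc (expi t) = 1.
Proof. by rewrite /= cos2Dsin2 sqrtr1. Qed.

Lemma expiN (t : R) : expi (- t) = (expi t)^*.
Proof. by rewrite /expi cosN sinN. Qed.
End Normc.

Section TrigPoly.
Variable R : realType.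
Implicit Types (T U : seq (R[i] * R)) (L : R -> R).

(* A list of pairs (a_j, lambda_j) stands for sum_j a_j e^(i lambda_j t); an
   additive L : R -> R stands for the character lambda |-> e^(i L(lambda)). *)
Definition tp_eval T L : R[i] := \sum_(p <- T) p.1 * expi (L p.2).

Definition tp_fun T (t : R) : R[i] := tp_eval T (fun l => l * t).

Definition tp_mul T U := [seq (p.1 * q.1, p.2 + q.2) | p <- T, q <- U].

Definition tp_exp T n := iter n (tp_mul T) [:: (1, 0)].

Definition tp_coef T (nu : R) := \sum_(p <- T | p.2 == nu) p.1.

Lemma tp_eval_cat T U L : tp_eval (T ++ U) L = tp_eval T L + tp_eval U L.
Proof. by rewrite /tp_eval big_cat. Qed.

Lemma tp_eval_mul T U L : {morph L : x y / x + y} ->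
  tp_eval (tp_mul T U) L = tp_eval T L * tp_eval U L.
Proof.
move=> LD; rewrite /tp_eval big_allpairs_dep mulr_suml; apply: eq_bigr => p _.
by rewrite mulr_sumr; apply: eq_bigr => q _ /=; rewrite LD expiD mulrACA.
Qed.

Lemma morph0 L : {morph L : x y / x + y} -> L 0 = 0.
Proof. by move=> LD; apply: (addrI (L 0)); rewrite -LD !addr0. Qed.

Lemma morphN L x : {morph L : x y / x + y} -> L (- x) = - L x.
Proof. by move=> LD; apply: (addrI (L x)); rewrite -LD !subrr morph0. Qed.

Lemma tp_eval_exp T n L : {morph L : x y / x + y} ->
  tp_eval (tp_exp T n) L = tp_eval T L ^+ n.
Proof.
move=> LD; elim: n => [|n IH]; last by rewrite exprS -IH -tp_eval_mul.
by rewrite /tp_eval big_seq1 /= morph0 // expi0 mulr1.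
Qed.

Lemma tp_eval_collect T L :
  tp_eval T L = \sum_(nu <- undup (map snd T)) tp_coef T nu * expi (L nu).
Proof.
rewrite /tp_eval /tp_coef; under [RHS]eq_bigr => nu _ do rewrite mulr_suml big_mkcond.
rewrite exchange_big /=; rewrite big_seq [RHS]big_seq; apply: eq_bigr => p pT.
rewrite -big_mkcond (eq_bigl (pred1 p.2)); last by move=> nu; rewrite /= eq_sym.
rewrite (big_rem p.2) /=; last by rewrite mem_undup map_f.
rewrite eqxx big1_seq ?addr0 // => nu /andP[/eqP->].
by rewrite mem_rem_uniqF ?undup_uniq.
Qed.

(** Termwise integration: a nonzero frequency has a bounded primitive, so the linear growth comes
    from the frequency 0 alone. *)
Lemma tp_primitive T : exists (G : R -> R) (B : R),
  (forall t : R, is_derive t 1 G (complex.Re (tp_fun T t))) /\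
  (forall t : R, `|G t - complex.Re (tp_coef T 0) * t| <= B).
Proof.
elim: T => [|[c l] T [G [B [dG GB]]]].
  exists (cst 0), 0; split => t.
    by rewrite /tp_fun /tp_eval big_nil; exact: is_derive_cst.
  by rewrite /tp_coef big_nil mul0r subrr normr0.
have ev t : complex.Re (tp_fun ((c, l) :: T) t) =
    (complex.Re c * cos (l * t) - complex.Im c * sin (l * t)) + complex.Re (tp_fun T t).
  by rewrite /tp_fun /tp_eval big_cons Re_addc Re_mulc.
rewrite /tp_coef big_cons /=; case: eqVneq => [l0|l0].
  exists (fun t => complex.Re c * t + G t), B; split => t.
    have d := is_deriveD (is_deriveM (is_derive_cst (complex.Re c) t 1)
      (is_derive_id t 1)) (dG t).
    rewrite ev; apply: (is_derive_eq d).
    by rewrite l0 mul0r cos0 sin0 /= !scaler0 mulr0 subr0 addr0.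
  by rewrite Re_addc mulrDl opprD addrACA subrr add0r; exact: GB.
exists (fun t => (complex.Re c / l * sin (l * t) + complex.Im c / l * cos (l * t)) + G t).
exists (`|complex.Re c / l| + `|complex.Im c / l| + B); split => t.
  have dl : is_derive t 1 ( *%R l) l.
    apply: (is_derive_eq (is_deriveM (is_derive_cst l t 1) (is_derive_id t 1))).
    by rewrite scaler0 addr0 -[LHS]/(l * 1) mulr1.
  have ds := is_deriveM (is_derive_cst (complex.Re c / l) t 1)
     (is_derive1_comp (is_derive_sin (l * t)) dl).
  have dc := is_deriveM (is_derive_cst (complex.Im c / l) t 1)
     (is_derive1_comp (is_derive_cos (l * t)) dl).
  rewrite ev; apply: (is_derive_eq (is_deriveD (is_deriveD ds dc) (dG t))).
  rewrite !scaler0 !addr0; congr (_ + _).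
  rewrite -![_ *: _]/(_ * _) /cst; field. exact: l0.
rewrite -addrA; apply: le_trans (ler_normD _ _) _; apply: lerD (GB t).
apply: le_trans (ler_normD _ _) _; rewrite !normrM; apply: lerD.
  by rewrite ler_piMr ?sin_max // -normrM.
by rewrite ler_piMr ?cos_max // -normrM.
Qed.

Lemma Re_coef0_le T (rho : R) : (forall t, normc (tp_fun T t) <= rho) ->
  `|complex.Re (tp_coef T 0)| <= rho.
Proof.
move=> Trho; have [G [B [dG GB]]] := tp_primitive T.
set A := complex.Re _ in GB *; rewrite leNgt; apply/negP => rhoA.
have B0 : 0 <= B by apply: le_trans (GB 0).
(* With this length, [(|A| - rho) * X] is 2B + 1, whereas the mean value theorem on [0, X] bounds it
   by 2B. *)
pose X := (B + B + 1) / (`|A| - rho).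
have X0 : 0 < X by rewrite divr_gt0 ?subr_gt0 // ltr_wpDl // addr_ge0.
have cG : {within `[0, X], continuous G}.
  by apply: derivable_within_continuous => t _; case: (dG t).
have [c _ cE] := @MVT _ G _ 0 X X0 (fun t _ => dG t) cG.
have : `|A * X| <= rho * X + B + B.
  have -> : A * X = (G X - G 0) - (G X - A * X) + (G 0 - A * 0) by ring.
  apply: le_trans (ler_normD _ _) _; apply: lerD (GB 0).
  apply: le_trans (ler_normB _ _) _; apply: lerD (GB X).
  rewrite cE subr0 normrM (gtr0_norm X0) ler_pM2r //.
  by apply: le_trans (Re_le_normc _) (Trho c).
rewrite normrM (gtr0_norm X0) -addrA -lerBlDl -mulrBl /X mulrC divfK.
  by rewrite gerDl ler10.
by rewrite gt_eqF // subr_gt0.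
Qed.

(** Multiplication by e^(-i nu t) moves the frequency [nu] to 0; a further factor 1 or -i gives
    access to the real or the imaginary part. The lost factor 2 disappears when n-th roots are
    taken. *)
Lemma normc_coef_le T (rho nu : R) : (forall t, normc (tp_fun T t) <= rho) ->
  normc (tp_coef T nu) <= rho + rho.
Proof.
move=> Trho.
pose S (a : R[i]) := tp_mul [:: (a, - nu)] T.
have Sfun a t : tp_fun (S a) t = a * expi (- nu * t) * tp_fun T t.
  rewrite /tp_fun tp_eval_mul; last by move=> x y; rewrite mulrDl.
  by rewrite {1}/tp_eval big_seq1.
have Scoef a : tp_coef (S a) 0 = a * tp_coef T nu.
  rewrite /S /tp_mul /= cats0 /tp_coef big_map mulr_sumr; apply: eq_bigl => p /=.
  by rewrite addrC subr_eq0.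
have Sle a t : normc a = 1 -> normc (tp_fun (S a) t) <= rho.
  by move=> a1; rewrite Sfun !normcM a1 normc_expi !mul1r.
apply: le_trans (normc_le_ReIm _) _; apply: lerD.
  by have := Re_coef0_le (fun t => Sle 1 t (normc1 _)); rewrite Scoef mul1r.
have n1 : normc (- 'i : R[i]) = 1.
  by rewrite normcN /= expr0n expr1n add0r sqrtr1.
have := Re_coef0_le (fun t => Sle _ t n1); rewrite Scoef Re_mulc /=.
by rewrite oppr0 mul0r sub0r mulNr opprK mul1r.
Qed.

(** Each frequency of the n-th power is a combination of the frequencies of [T] with multiplicities
    between 0 and [n]; their number thus grows only polynomially in [n]. *)
Lemma size_freqs_exp T n :
  (size (undup (map snd (tp_exp T n))) <= n.+1 ^ size T)%N.
Proof.
pose mu (f : {ffun 'I_(size T) -> 'I_n.+1}) :=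
  \sum_(k < size T) (nth (0, 0) T k).2 *+ f k.
rewrite -[n.+1 in leqRHS]card_ord -[size T in leqRHS]card_ord -card_ffun.
rewrite -(size_codom mu); apply: uniq_leq_size; first exact: undup_uniq.
move=> nu; rewrite mem_undup => /mapP[q qT ->] {nu}.
suff [f fn ->] : exists2 f : nat -> nat, (forall k, f k <= n)%N &
    q.2 = \sum_(k < size T) (nth (0, 0) T k).2 *+ f k.
  apply/codomP; exists [ffun k : 'I_(size T) => inord (f k)]; apply: eq_bigr => k _.
  by rewrite ffunE inordK // ltnS.
elim: n q qT {mu} => [|n IH] q /=.
  rewrite inE => /eqP->; exists (fun=> 0%N) => //.
  by rewrite big1 // => k _; rewrite mulr0n.
case/allpairsP => -[p r] /= [pT rT ->] /=; have [f fn ->] := IH _ rT.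
exists (fun k => (k == index p T) + f k)%N.
  by move=> k; have := fn k; case: eqP => _; lia.
under [RHS]eq_bigr => k _ do rewrite mulrnDr; rewrite big_split /=.
have pT' := pT; rewrite -index_mem in pT'.
congr (_ + _); rewrite (bigD1 (Ordinal pT')) //= eqxx nth_index //.
rewrite big1 ?addr0 // => k kp; rewrite -val_eqE /= in kp.
by rewrite (negbTE kp).
Qed.

Lemma le1_exp_le_polynomial (q : R) m : 0 <= q ->
  (forall n, q ^+ n <= 2 * (n.+1 ^ m)%:R) -> q <= 1.
Proof.
move=> q0 qn; rewrite leNgt; apply/negP => q1.
pose d := q - 1; have d0 : 0 < d by rewrite subr_gt0.
have bern k : k%:R * d <= q ^+ k.
  suff : 1 + k%:R * d <= q ^+ k by apply: le_trans; rewrite lerDr.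
  elim: k => [|k IH]; first by rewrite mul0r addr0.
  rewrite exprS; apply: le_trans (ler_wpM2l q0 IH).
  have -> : q = 1 + d by rewrite addrC subrK.
  rewrite -[k.+1]addn1 natrD -subr_ge0.
  have -> : (1 + d) * (1 + k%:R * d) - (1 + (k%:R + 1) * d) = k%:R * d ^+ 2 by ring.
  by rewrite mulr_ge0 ?sqr_ge0 ?ler0n.
(* At the exponent K(m+1), Bernoulli gives at least (K d)^(m+1), while the hypothesis gives at most
   2 (m+2)^m K^m; these conflict once K exceeds [c]. *)
pose c : R := 2 * (m.+2 ^ m)%:R / d ^+ m.+1.
have [K Kc] : exists K, (0 < K)%N /\ c < K%:R.
  exists (Num.bound c).+1; split=> //; apply: lt_le_trans (archi_boundP _) _.
    by rewrite divr_ge0 ?mulr_ge0 ?ler0n // exprn_ge0 // ltW.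
  by rewrite ler_nat.
case: Kc => K0; rewrite ltr_pdivrMr ?exprn_gt0 //; apply/negP; rewrite -leNgt.
have K0' : 0 < K%:R ^+ m :> R by rewrite exprn_gt0 // ltr0n.
rewrite -(ler_pM2r K0') -mulrA [_ * K%:R ^+ m]mulrC mulrA -exprS -exprMn.
apply: le_trans (_ : q ^+ (K * m.+1) <= _).
  rewrite exprM; apply: lerXn2r (bern K); rewrite nnegrE ?exprn_ge0 //.
  by rewrite mulr_ge0 ?ler0n // ltW.
apply: le_trans (qn _) _; rewrite -mulrA ler_pM2l ?ltr0n // -natrX -natrM.
rewrite ler_nat [leqRHS]mulnC -expnMn.
case: (m) => // e; rewrite leq_exp2r //; nia.
Qed.

(* T^n has at most n.+1 ^ size T frequencies, and its coefficients are bounded by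
   means of its values on the real line: take n-th roots. *)
Lemma tp_eval_le_sup T L (rho : R) : {morph L : x y / x + y} ->
  (forall t, normc (tp_fun T t) <= rho) -> normc (tp_eval T L) <= rho.
Proof.
move=> LD Trho; have rho0 : 0 <= rho by apply: le_trans (normc_ge0 _) (Trho 0).
have pow n : normc (tp_eval T L) ^+ n <= 2 * (n.+1 ^ size T)%:R * rho ^+ n.
  rewrite -normcX -tp_eval_exp // tp_eval_collect.
  apply: le_trans (normc_sum _ _ _) _.
  apply: le_trans (_ : \sum_(nu <- undup [seq i.2 | i <- tp_exp T n])
    (rho ^+ n + rho ^+ n) <= _).
    apply: ler_sum => nu _; rewrite normcM normc_expi mulr1.
    apply: normc_coef_le => t; rewrite /tp_fun tp_eval_exp.
      by rewrite normcX lerXn2r ?nnegrE ?normc_ge0 ?Trho.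
    by move=> x y; rewrite mulrDl.
  rewrite big_const_seq count_predT iter_addr_0 -mulr2n -[leLHS]mulr_natr -[X in X * _ <= _]mulr_natl.
  rewrite [leRHS]mulrAC. apply: ler_wpM2l.
    by rewrite mulr_ge0 ?ler0n ?exprn_ge0.
  by rewrite ler_nat size_freqs_exp.
have [r0|r0] := eqVneq rho 0.
  by have := pow 1%N; rewrite expr1 r0 expr1 mulr0.
have {}r0 : 0 < rho by rewrite lt0r r0.
rewrite -(ler_pM2r (_ : 0 < rho^-1)) ?invr_gt0 // divff ?gt_eqF //.
apply: (@le1_exp_le_polynomial _ (size T)) => [|n].
  by rewrite divr_ge0 ?normc_ge0.
by rewrite exprMn exprVn ler_pdivrMr ?exprn_gt0.
Qed.
End TrigPoly.

Section TrigPolyOps.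
Variable R : realType.
Implicit Types (T U : seq (R[i] * R)) (L : R -> R).

Definition tp_scale (c : R[i]) T := [seq (c * p.1, p.2) | p <- T].

Definition tp_conj T := [seq (p.1^*, - p.2) | p <- T].

Lemma tp_eval_scale c T L : tp_eval (tp_scale c T) L = c * tp_eval T L.
Proof.
by rewrite /tp_eval big_map mulr_sumr; apply: eq_bigr => p _; rewrite mulrA.
Qed.

Lemma tp_eval_conj T L : {morph L : x y / x + y} ->
  tp_eval (tp_conj T) L = (tp_eval T L)^*.
Proof.
move=> LD; rewrite /tp_eval big_map rmorph_sum; apply: eq_bigr => p _ /=.
by rewrite morphN // expiN -rmorphM.
Qed.

Lemma tp_eval_flatten (I : Type) (r : seq I) (F : I -> seq (R[i] * R)) L :
  tp_eval (flatten [seq F j | j <- r]) L = \sum_(j <- r) tp_eval (F j) L.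
Proof. by rewrite /tp_eval big_flatten big_map. Qed.

Lemma normc_tp_eval T L : normc (tp_eval T L) <= \sum_(p <- T) normc p.1.
Proof.
apply: le_trans (normc_sum _ _ _) _; apply: ler_sum => p _.
by rewrite normcM normc_expi mulr1.
Qed.

Lemma mulcJ_normc (z : R[i]) : z * z^* = (normc z ^+ 2)%:C.
Proof.
rewrite normcE2; apply/eqP; rewrite eq_complex; case: z => a b /=.
by apply/andP; split; apply/eqP; ring.
Qed.

Lemma normc_real (x : R) : normc x%:C = `|x|.
Proof. by rewrite /= expr0n addr0 sqrtr_sqr. Qed.

(* C - sum_j |Q_j|^2 is a trigonometric polynomial, nonnegative at all the
   characters for C large. *)
Lemma sum_normc_sq_transfer n (Q : 'I_n -> seq (R[i] * R)) (c : R) L :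
  {morph L : x y / x + y} ->
  (forall t, c <= \sum_j normc (tp_fun (Q j) t) ^+ 2) ->
  c <= \sum_j normc (tp_eval (Q j) L) ^+ 2.
Proof.
move=> LD Qc; pose C := \sum_j (\sum_(p <- Q j) normc p.1) ^+ 2.
pose T := (C%:C, 0) :: tp_scale (-1)
  (flatten [seq tp_mul (Q j) (tp_conj (Q j)) | j <- enum 'I_n]).
have evT M : {morph M : x y / x + y} ->
    tp_eval T M = (C - \sum_j normc (tp_eval (Q j) M) ^+ 2)%:C.
  move=> MD; rewrite {1}/tp_eval big_cons -/(tp_eval _ M) /= morph0 // expi0 mulr1.
  rewrite tp_eval_scale tp_eval_flatten big_enum /= mulN1r.
  rewrite rmorphB; congr (_ - _); rewrite rmorph_sum; apply: eq_big => [j|j _]; first by rewrite inE.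
  by rewrite tp_eval_mul // tp_eval_conj // mulcJ_normc.
have Cge M : \sum_j normc (tp_eval (Q j) M) ^+ 2 <= C.
  apply: ler_sum => j _; rewrite lerXn2r ?nnegrE ?normc_ge0 ?normc_tp_eval //.
  by apply: sumr_ge0 => p _; exact: normc_ge0.
have muleD (t : R) : {morph (fun l => l * t) : x y / x + y}.
  by move=> x y; rewrite mulrDl.
have /(tp_eval_le_sup LD) : forall t, normc (tp_fun T t) <= C - c.
  move=> t; rewrite /tp_fun evT // normc_real ger0_norm ?subr_ge0 ?Cge //.
  by rewrite lerD2l lerN2; exact: Qc.
rewrite evT // normc_real ger0_norm ?subr_ge0 ?Cge //.
by rewrite lerD2l lerN2.
Qed.
End TrigPolyOps.

(** * Trigonometric polynomials as almost periodic functions *)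

Section Membership.
Variable R : realType.
Implicit Types (T U : seq (R[i] * R)) (f : R -> R[i]).

Lemma is_derive_lipschitz (f df : R -> R) : (forall x : R, is_derive x 1 f (df x)) ->
  (forall x, `|df x| <= 1) -> forall s t, `|f s - f t| <= `|s - t|.
Proof.
move=> dff df1 s t; wlog ts : s t / t <= s => [H|].
  by have [/H//|/ltW/H] := leP t s; rewrite (distrC s) (distrC (f s)).
have cf : {within `[t, s], continuous f}.
  by apply: derivable_within_continuous => x _; case: (dff x).
have [c _ ->] := MVT_segment ts (fun x _ => dff x) cf.
by rewrite normrM ler_piMl.
Qed.

Lemma sin_lipschitz (s t : R) : `|sin s - sin t| <= `|s - t|.
Proof. exact: (is_derive_lipschitz (@is_derive_sin R) (@cos_max R)). Qed.

Lemma cos_lipschitz (s t : R) : `|cos s - cos t| <= `|s - t|.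
Proof.
apply: (is_derive_lipschitz (@is_derive_cos R)) => x; rewrite normrN; exact: sin_max.
Qed.

Lemma supnorm_le f (M : R) : (forall t, normc (f t) <= M) ->
  (supnorm f <= M%:E)%E.
Proof. by move=> fM; apply: ge_ereal_sup => _ [t _ <-]; rewrite lee_fin. Qed.

Lemma normc_le_supnorm f (t : R) : ((normc (f t))%:E <= supnorm f)%E.
Proof. by apply: ereal_sup_ubound; exists t. Qed.

Lemma normc_lt_supnorm f (e t : R) : (supnorm f < e%:E)%E -> normc (f t) < e.
Proof. by move=> fe; rewrite -lte_fin; apply: le_lt_trans fe; exact: normc_le_supnorm. Qed.

Lemma Cb_bounded f : Cb f -> exists M : R, forall t, normc (f t) <= M.
Proof.
case=> _ foo; exists (fine (supnorm f)) => t; rewrite -lee_fin fineK.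
  exact: normc_le_supnorm.
rewrite fin_numE; apply/andP; split; last by rewrite lt_eqF.
by apply: contraTneq (normc_le_supnorm f 0) => ->; rewrite leeNy_eq.
Qed.

Lemma AP_approx f (e : R) : AP f -> 0 < e ->
  exists T, forall t, normc (f t - tp_fun T t) < e.
Proof.
case=> _ /[apply] -[Q [N [a [l [_ QE]]]] fQ].
exists [seq (a j, l j) | j <- enum 'I_N] => t.
rewrite /tp_fun /tp_eval big_map enumT -QE.
exact: (normc_lt_supnorm t fQ).
Qed.

Lemma expi_lipschitz (s t : R) : normc (expi s - expi t) <= `|s - t| + `|s - t|.
Proof.
apply: le_trans (normc_le_ReIm _) _; rewrite Re_subc Im_subc.
by apply: lerD; [exact: cos_lipschitz|exact: sin_lipschitz].
Qed.

Lemma gt0_complexE (z : R[i]) : 0 < z -> exists2 e : R, 0 < e & z = e%:C.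
Proof. by case: z => a b; rewrite ltcE /= => /andP[/eqP-> a0]; exists a. Qed.

Lemma normC_ltE (z : R[i]) (e : R) : (`|z| < e%:C) = (normc z < e).
Proof. by rewrite -ltcR; case: z. Qed.

Lemma tp_fun_lipschitz T : exists2 K : R, 0 < K &
  forall s t, normc (tp_fun T s - tp_fun T t) <= K * `|s - t|.
Proof.
exists (\sum_(p <- T) normc p.1 * (2 * `|p.2|) + 1) => [|s t].
  by rewrite ltr_wpDl // sumr_ge0 // => p _; rewrite !mulr_ge0 ?normc_ge0.
rewrite /tp_fun /tp_eval -sumrB; apply: le_trans (normc_sum _ _ _) _.
rewrite mulrDl mul1r; apply: le_trans (_ : _ <= _ + 0) (lerD _ (normr_ge0 _)) => //.
rewrite addr0 mulr_suml; apply: ler_sum => p _; rewrite -mulrBr normcM -mulrA.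
apply: ler_wpM2l; first exact: normc_ge0.
apply: le_trans (expi_lipschitz _ _) _.
by rewrite -mulrBr normrM -mulrA mulr_natl mulr2n.
Qed.

Lemma continuous_tp_fun T : continuous (tp_fun T : R -> R[i]^o).
Proof.
have [K K0 lipT] := tp_fun_lipschitz T.
move=> t; apply/cvgrPdist_lt => _ /gt0_complexE[e e0 ->].
near=> s; rewrite normC_ltE; apply: le_lt_trans (lipT _ _) _.
rewrite mulrC -ltr_pdivlMr //; near: s.
by apply: (@nbhsx_ballx R R^o t (e/K)); rewrite divr_gt0.
Unshelve. all: by end_near. Qed.

Lemma continuous_Re_tp_fun T : continuous (fun t => complex.Re (tp_fun T t)).
Proof.
have [K K0 lipT] := tp_fun_lipschitz T.
move=> t; apply/cvgrPdist_lt => e e0.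
near=> s; rewrite -Re_subc; apply: le_lt_trans (Re_le_normc _) _.
apply: le_lt_trans (lipT _ _) _; rewrite mulrC -ltr_pdivlMr //; near: s.
by apply: (@nbhsx_ballx R R^o t (e/K)); rewrite divr_gt0.
Unshelve. all: by end_near. Qed.

Lemma tp_fun_AP T : AP (tp_fun T).
Proof.
split.
  split; first exact: continuous_tp_fun.
  exact: le_lt_trans (supnorm_le (fun t => normc_tp_eval T _)) (ltry _).
move=> e e0; exists (tp_fun T).
  (* A null term is added because [trig_poly] requires at least one term, while [T] may be empty. *)
  pose S := (0, 0) :: T; exists (size S), (fun j => (nth (0, 0) S j).1),
    (fun j => (nth (0, 0) S j).2); split => // t.
  have -> : tp_fun T t = tp_fun S t.
    by rewrite /tp_fun /tp_eval big_cons mul0r add0r.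
  by rewrite /tp_fun /tp_eval (big_nth (0, 0)) big_mkord.
apply: le_lt_trans (_ : (0%:E < _)%E); last by rewrite lte_fin.
by apply: supnorm_le => t; rewrite subrr normc0.
Qed.

Lemma Rintegral_Re_tp_fun T (G : R -> R) (a b : R) : a < b ->
  (forall t : R, is_derive t 1 G (complex.Re (tp_fun T t))) ->
  \int[lebesgue_measure]_(t in `[a, b]) complex.Re (tp_fun T t) = G b - G a.
Proof.
move=> ab dG; rewrite /Rintegral (@continuous_FTC2 _ _ G) //.
- by apply: continuous_subspaceT; exact: continuous_Re_tp_fun.
- split => [x _||]. by case: (dG x).
    by apply: cvg_at_right_filter; apply/differentiable_continuous/derivable1_diffP; case: (dG a).
  by apply: cvg_at_left_filter; apply/differentiable_continuous/derivable1_diffP; case: (dG b).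
- by move=> x _; rewrite derive1E; apply: derive_val.
Qed.

Lemma mean_tp_fun T : exists2 B : R, 0 < B & forall a b : R, a < b ->
  normc (mean (tp_fun T) (a, b) - tp_coef T 0) <= B / (b - a).
Proof.
(* The imaginary part is the real part of -i times the polynomial, so that [tp_primitive] serves for
   both. *)
pose T' := tp_scale (- 'i) T.
have T'fun t : tp_fun T' t = - 'i * tp_fun T t by exact: tp_eval_scale.
have T'coef : tp_coef T' 0 = - 'i * tp_coef T 0.
  by rewrite /tp_coef big_map mulr_sumr.
have ReT' (z : R[i]) : complex.Re (- 'i * z) = complex.Im z.
  by rewrite Re_mulc /= oppr0 mul0r sub0r mulNr opprK mul1r.
have [G [B [dG GB]]] := tp_primitive T.
have [G' [B' [dG' GB']]] := tp_primitive T'.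
have B0 : 0 <= B by apply: le_trans (GB 0).
have B'0 : 0 <= B' by apply: le_trans (GB' 0).
exists (2 * (B + B') + 1) => [|a b ab]; first by rewrite ltr_wpDl ?mulr_ge0 ?addr_ge0.
have ba : 0 < b - a by rewrite subr_gt0.
have key (H : R -> R) (A C : R) : (forall t, `|H t - A * t| <= C) ->
    `|(b - a)^-1 * (H b - H a) - A| <= 2 * C / (b - a).
  move=> HC; have -> : (b - a)^-1 * (H b - H a) - A =
      ((H b - A * b) - (H a - A * a)) / (b - a).
    by field; rewrite gt_eqF.
  rewrite normrM normfV (gtr0_norm ba) ler_pM2r ?invr_gt0 //.
  by apply: le_trans (ler_normB _ _) _; rewrite mulr_natl mulr2n lerD.
have ImE : \int[lebesgue_measure]_(t in `[a, b]) complex.Im (tp_fun T t) = G' b - G' a.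
  rewrite -(Rintegral_Re_tp_fun ab dG'); congr Rintegral.
  by apply/funext => t; rewrite T'fun ReT'.
rewrite T'coef ReT' in GB'.
apply: le_trans (normc_le_ReIm _) _; rewrite Re_subc Im_subc /mean Re_mulc Im_mulc /=.
rewrite (Rintegral_Re_tp_fun ab dG) ImE !mul0r subr0 addr0.
apply: le_trans (lerD (key _ _ _ GB) (key _ _ _ GB')) _.
by rewrite -mulrDl -mulrDr ler_pM2r ?invr_gt0 // lerDl.
Qed.

(** After the shift of frequency, the mean over an interval differs from the coefficient by
    O(1/length). This reduces membership in [APin] to inspecting a list of frequencies. *)
Lemma bohr_coef_tp_fun T (l : R) : bohr_coef (tp_fun T) l = tp_coef T l.
Proof.
pose S := tp_mul [:: (1, - l)] T.
have Sfun t : tp_fun T t * expi (- (l * t)) = tp_fun S t.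
  rewrite /tp_fun tp_eval_mul; last by move=> x y; rewrite mulrDl.
  by rewrite mulrC; congr (_ * _); rewrite /tp_eval big_seq1 mul1r mulNr.
have Scoef : tp_coef S 0 = tp_coef T l.
  rewrite /S /tp_mul /= cats0 /tp_coef big_map.
  apply: eq_big => p /=; first by rewrite addrC subr_eq0.
  by rewrite mul1r.
rewrite /bohr_coef (_ : (fun t => _) = tp_fun S); last exact/funext.
rewrite -Scoef. apply: (@cvg_lim R[i]^o); first exact: norm_hausdorff.
have [B B0 SB] := mean_tp_fun S.
apply/cvgrPdist_lt => _ /gt0_complexE[e e0 ->].
exists (B / e); split; first exact: num_real.
move=> L BL [a b] /= Lab.
have ba : 0 < b - a.
  by apply: lt_le_trans Lab; apply: lt_trans BL; rewrite divr_gt0.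
rewrite normC_ltE -normcN opprB; apply: le_lt_trans (SB _ _ _) _.
  by rewrite -subr_gt0.
rewrite ltr_pdivrMr // mulrC -ltr_pdivrMr //.
exact: lt_le_trans Lab.
Qed.

Lemma tp_fun_APin T (Lambda : set R) :
  (forall p, p \in T -> Lambda p.2) -> APin Lambda (tp_fun T).
Proof.
move=> TL; split; first exact: tp_fun_AP.
move=> l; rewrite /bohr_spectrum /mkset bohr_coef_tp_fun; apply: contra_neqP => nl.
rewrite /tp_coef big_seq_cond big1 // => p /andP[pT /eqP pl].
by case: nl; rewrite -pl; exact: TL.
Qed.
End Membership.

(** * Additive functionals *)

Section DualFunctionals.
Variable R : realType.
Implicit Types (V S : set R).

Definition Qclosed V := forall q x y, V x -> V y -> V (ratr q * x + y).

Lemma Qspan0 S : Qspan S 0.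
Proof. by exists 0, (fun=> 0), (fun=> 0); split => [[]//|]; rewrite big_ord0. Qed.

Lemma sub_Qspan S : S `<=` Qspan S.
Proof.
move=> x Sx; exists 1, (fun=> 1), (fun=> x); split=> //.
by rewrite big_ord1 rmorph1 mul1r.
Qed.

Lemma Qspan_closed S : Qclosed (Qspan S).
Proof.
move=> q _ _ [n [a [v [Sv ->]]]] [m [b [w [Sw ->]]]].
exists (n + m)%N, (fun i : 'I_(n + m) => match fintype.split i with inl j => q * a j | inr j => b j end),
  (fun i : 'I_(n + m) => match fintype.split i with inl j => v j | inr j => w j end).
split=> [i|]; first by case: fintype.split.
rewrite big_split_ord /= mulr_sumr; congr (_ + _); apply: eq_bigr => i _.
  by rewrite (unsplitK (inl _ i)) rmorphM mulrA.
by rewrite (unsplitK (inr _ i)).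
Qed.

Lemma Qspan_min S V : V 0 -> Qclosed V -> S `<=` V -> Qspan S `<=` V.
Proof.
move=> V0 VQ SV _ [n [q [v [Sv ->]]]]; elim: n q v Sv => [|n IH] q v Sv.
  by rewrite big_ord0.
by rewrite big_ord_recl; apply: VQ; [exact/SV|apply: IH => i; exact: Sv].
Qed.

(** Zorn's lemma gives a rational subspace maximal among those containing [V] and avoiding [x];
    maximality forces the line spanned by [x] to be a complement. *)
Lemma maximal_hyperplane V (x : R) : V 0 -> Qclosed V -> ~ V x ->
  exists H : set R, [/\ V `<=` H, Qclosed H, ~ H x &
    forall y, exists q, H (y - ratr q * x)].
Proof.
move=> V0 VQ Vx.
(* P has to hold of set0, the union of the empty chain. *)
pose P X := ~ X x /\ (X !=set0 -> Qclosed X /\ V `<=` X).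
have [|H [[Hx HP] Hmax]] := @Zorn_bigcup _ P.
  move=> F FP Ftot; split=> [[X FX Xx]|[x0 [X0 FX0 X0x]]].
    by case: (FP _ FX) => /(_ Xx).
  have FQ X y : F X -> X y -> Qclosed X /\ V `<=` X.
    by move=> FX Xy; case: (FP _ FX) => _; apply; exists y.
  split=> [q y z [X FX Xy] [Y FY Yz]|]; last first.
    by move=> y /(proj2 (FQ _ _ FX0 X0x)); exists X0.
  have [XY|YX] := Ftot _ _ FX FY.
    by exists Y => //; apply: (proj1 (FQ _ _ FY Yz)) => //; exact: XY.
  by exists X => //; apply: (proj1 (FQ _ _ FX Xy)) => //; exact: YX.
have H0 : H !=set0.
  apply/set0P/negP => /eqP H0; apply: (Hmax V); last by split=> // _; split.
  by rewrite H0; split=> // /(_ _ V0).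
have {HP H0}[HQ VH] := HP H0; exists H; split=> // y.
have [Hy|nHy] := pselect (H y).
  by exists 0; rewrite rmorph0 mul0r subr0.
(* [H'] is H + Q y, strictly larger than [H], hence it contains [x]; the resulting relation is then
   solved for [y]. *)
pose H' := [set z | exists r, H (z - ratr r * y)].
have Ha r z w : H z -> H w -> H (ratr r * z + w) by exact: HQ.
have [r Hr] : H' x.
  apply: contrapT => H'x; apply: (Hmax H').
    split; last first.
      move/(_ y); apply/not_implyP; split => //.
      by exists 1; rewrite rmorph1 mul1r subrr; exact: VH.
    by move=> z Hz; exists 0; rewrite rmorph0 mul0r subr0.
  split=> // _; split; last first.
    by move=> z /VH Hz; exists 0; rewrite rmorph0 mul0r subr0.
  move=> q z w [r1 Hz] [r2 Hw]; exists (q * r1 + r2).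
  have -> : ratr q * z + w - ratr (q * r1 + r2) * y =
     ratr q * (z - ratr r1 * y) + (w - ratr r2 * y).
    by rewrite rmorphD rmorphM /=; ring.
  exact: HQ.
have r0 : r != 0.
  by apply: contra_notN Hx => /eqP r0; move: Hr; rewrite r0 rmorph0 mul0r subr0.
exists r^-1; have -> : y - ratr r^-1 * x = ratr (- r^-1) * (x - ratr r * y) + 0.
  by rewrite rmorphN fmorphV; field; rewrite fmorph_eq0.
by apply: HQ => //; exact: VH.
Qed.

(** The functional is the coordinate along [x] modulo the hyperplane [H]; it is well defined because
    two different values would put a nonzero multiple of [x] into [H]. *)
Lemma separating_functional V (x : R) : V 0 -> Qclosed V -> ~ V x ->
  exists l : R -> R, [/\ {morph l : y z / y + z}, forall y, V y -> l y = 0 & l x = 1].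
Proof.
move=> V0 VQ Vx; have [H [VH HQ Hx /choice[q Hq]]] := maximal_hyperplane V0 VQ Vx.
have H0 := VH _ V0.
have qE y r : H (y - ratr r * x) -> q y = r.
  move=> Hr; apply: contrapT => /eqP qr; apply: Hx.
  have nz : ratr (q y - r) != 0 :> R by rewrite fmorph_eq0 subr_eq0.
  have -> : x = ratr (- (q y - r)^-1) * (ratr (-1) * (y - ratr r * x) + (y - ratr (q y) * x)) + 0.
    move: nz; rewrite !rmorphN fmorphV !rmorphB /= rmorph1 => nz; field.
    by [].
  by do 2!apply: (HQ) => //.
exists (fun y => ratr (q y)); split=> [y z|y /VH Hy|].
- rewrite -rmorphD; congr ratr; apply: qE; rewrite rmorphD /=.
  have -> : y + z - (ratr (q y) + ratr (q z)) * x =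
    ratr 1 * (y - ratr (q y) * x) + (z - ratr (q z) * x) by rewrite rmorph1; ring.
  exact: HQ.
- by rewrite (qE y 0) ?rmorph0 // mul0r subr0.
- by rewrite (qE x 1) ?rmorph1 // mul1r subrr.
Qed.

(** Induction on [m]: infinite dimension yields [mu] in [Lambda] outside the span of the previous
    frequencies, and a functional [f] killing that span with [f mu = 1]. Subtracting [l i mu] times
    [f] makes the earlier functionals vanish at [mu] without changing them on the earlier
    frequencies. *)
Lemma dual_family (Lambda : set R) m : ~ Qfinite_dim (Qspan Lambda) ->
  exists (lam : nat -> R) (l : nat -> R -> R),
  [/\ forall i, (i < m)%N -> Lambda (lam i),
      forall i, {morph l i : x y / x + y} &
      forall i j, (i < m)%N -> (j < m)%N -> l i (lam j) = (i == j)%:R].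
Proof.
move=> Linf; elim: m => [|m [lam [l [Llam lD ld]]]].
  by exists (fun=> 0), (fun=> fun=> 0); split=> // i x y; rewrite addr0.
pose s := [seq lam i | i <- iota 0 m].
have [mu Lmu smu] : exists2 mu, Lambda mu & ~ Qspan [set` s] mu.
  apply: contrapT => nmu; apply: Linf; exists s; rewrite eqEsubset; split.
    apply: Qspan_min; [exact: Qspan0|exact: Qspan_closed|].
    by move=> x Lx; apply: contrapT => nx; apply: nmu; exists x.
  apply: Qspan_min; [exact: Qspan0|exact: Qspan_closed|].
  move=> x /= sx; case: (elimT (@mapP _ _ lam (iota 0 m) x) sx) => i; rewrite mem_iota => /andP[_ im] ->.
  by apply/sub_Qspan/Llam.
have [f [fD fV fmu]] := separating_functional (Qspan0 _) (@Qspan_closed _) smu.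
have flam j : (j < m)%N -> f (lam j) = 0.
  by move=> jm; apply/fV/sub_Qspan/map_f; rewrite mem_iota.
exists (fun i => if i == m then mu else lam i),
  (fun i => if i == m then f else fun x => l i x - l i mu * f x).
split=> [i|i|i j].
- by rewrite ltnS leq_eqVlt; case: eqP => //= _; exact: Llam.
- by case: eqP => // _ x y; rewrite lD fD; ring.
have ltm k : k != m -> (k < m.+1)%N -> (k < m)%N.
  by move=> km; rewrite ltnS leq_eqVlt (negbTE km).
case: eqVneq => [->|im]; case: (eqVneq j m) => [->|jm] im' jm'.
- by rewrite fmu.
- by rewrite flam ?ltm // eq_sym (negbTE jm).
- by rewrite fmu mulr1 subrr (negbTE im).
- by rewrite flam ?ltm // mulr0 subr0 ld ?ltm.
Qed.
End DualFunctionals.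

(** * The Poincare-Miranda theorem up to an arbitrary error *)

Section Lipschitz.
Variables (R : realType) (n : nat).
Implicit Types (g h : ('I_n.+1 -> R) -> R).

(** One constant serves as bound and as Lipschitz constant for the sup distance; boundedness makes
    the class stable under products. *)
Definition bounded_lipschitz g := exists2 K : R, forall x, `|g x| <= K &
  forall x y d, (forall i, `|x i - y i| <= d) -> `|g x - g y| <= K * d.

Lemma bounded_lipschitz_cst (c : R) : bounded_lipschitz (fun=> c).
Proof.
exists `|c| => // x y d xyd; rewrite subrr normr0 mulr_ge0 //.
by apply: le_trans (xyd ord0).
Qed.

Lemma bounded_lipschitzD g h : bounded_lipschitz g -> bounded_lipschitz h ->
  bounded_lipschitz (fun x => g x + h x).
Proof.
move=> [K gK gl] [M hM hl]; exists (K + M) => [x|x y d xyd].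
  by apply: le_trans (ler_normD _ _) (lerD (gK x) (hM x)).
rewrite opprD addrACA mulrDl.
by apply: le_trans (ler_normD _ _) (lerD (gl _ _ _ xyd) (hl _ _ _ xyd)).
Qed.

Lemma bounded_lipschitzM g h : bounded_lipschitz g -> bounded_lipschitz h ->
  bounded_lipschitz (fun x => g x * h x).
Proof.
move=> [K gK gl] [M hM hl].
have K0 : 0 <= K by apply: le_trans (gK (fun=> 0)).
have M0 : 0 <= M by apply: le_trans (hM (fun=> 0)).
exists (K * M + K * M) => [x|x y d xyd].
  by rewrite normrM ler_wpDr ?mulr_ge0 // ler_pM.
have -> : g x * h x - g y * h y = (g x - g y) * h x + g y * (h x - h y) by ring.
apply: le_trans (ler_normD _ _) _; rewrite !normrM mulrDl.
rewrite [in X in _ <= X + _]mulrAC -[in X in _ <= _ + X]mulrA.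
by apply: lerD; apply: ler_pM => //; [exact: gl|exact: hl].
Qed.

Lemma bounded_lipschitz_sum (I : Type) (r : seq I) (g : I -> ('I_n.+1 -> R) -> R) :
  (forall i, bounded_lipschitz (g i)) ->
  bounded_lipschitz (fun x => \sum_(i <- r) g i x).
Proof.
move=> gl; elim: r => [|i r IH].
  rewrite (_ : (fun _ => _) = fun=> 0); first exact: bounded_lipschitz_cst.
  by apply/funext => x; rewrite big_nil.
rewrite (_ : (fun _ => _) = fun x => g i x + \sum_(i <- r) g i x).
  exact: bounded_lipschitzD.
by apply/funext => x; rewrite big_cons.
Qed.

Lemma bounded_lipschitz_max0 g :
  bounded_lipschitz g -> bounded_lipschitz (fun x => Num.max 0 (g x)).
Proof.
move=> [K gK gl]; exists K => [x|x y d xyd].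
  apply: le_trans (gK x); case: (leP 0 (g x)) => // _; rewrite normr0 //.
apply: le_trans (gl _ _ _ xyd).
case: (leP 0 (g x)) => gx; case: (leP 0 (g y)) => gy; rewrite ?subrr ?normr0 //.
  rewrite subr0 !ger0_norm ?subr_ge0 //; first by rewrite lerDl oppr_ge0 ltW.
  exact: ltW (lt_le_trans gy gx).
rewrite sub0r normrN distrC !ger0_norm ?subr_ge0 //; first by rewrite lerDl oppr_ge0 ltW.
exact: ltW (lt_le_trans gx gy).
Qed.

Lemma bounded_lipschitz_linear (f : R -> R) (k : 'I_n.+1 -> R) :
  (forall t, `|f t| <= 1) -> (forall s t, `|f s - f t| <= `|s - t|) ->
  bounded_lipschitz (fun x => f (\sum_i x i * k i)).
Proof.
move=> f1 fl; have S0 : 0 <= \sum_i `|k i| by apply: sumr_ge0.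
exists (1 + \sum_i `|k i|) => [x|x y d xyd].
  by apply: le_trans (f1 _) _; rewrite lerDl.
apply: le_trans (fl _ _) _; rewrite -sumrB.
have d0 : 0 <= d by apply: le_trans (xyd ord0).
apply: le_trans (_ : (\sum_i `|k i|) * d <= _); last first.
  by rewrite ler_wpM2r // lerDr.
rewrite mulr_suml; apply: le_trans (ler_norm_sum _ _ _) _.
apply: ler_sum => i _; rewrite -mulrBl normrM mulrC.
exact: ler_wpM2l.
Qed.

(** The discrete theorem is applied to the signs of [u] on a fine grid: in the cell found, each
    [u i] takes both a positive and a nonpositive value, and it varies by at most [e] from the lower
    corner. *)
Lemma poincare_miranda (r : R) (u : 'I_n.+1 -> ('I_n.+1 -> R) -> R) (e : R) :
  0 < r -> 0 < e -> (forall i, bounded_lipschitz (u i)) ->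
  (forall i x, (forall j, `|x j| <= r) -> x i = - r -> u i x <= 0) ->
  (forall i x, (forall j, `|x j| <= r) -> x i = r -> 0 < u i x) ->
  exists2 x, forall j, `|x j| <= r & forall i, `|u i x| <= e.
Proof.
move=> r0 e0 ul um up.
have [K uK] : exists K : R, forall i x y d, (forall j, `|x j - y j| <= d) ->
    `|u i x - u i y| <= K * d.
  have /choice[K KP] : forall i, exists K : R, forall x y d,
      (forall j, `|x j - y j| <= d) -> `|u i x - u i y| <= K * d.
    by move=> i; have [K _ ?] := ul i; exists K.
  exists (\sum_i `|K i|) => i x y d xyd; apply: le_trans (KP _ _ _ _ xyd) _.
  have d0 : 0 <= d by apply: le_trans (xyd ord0).
  apply: ler_wpM2r => //; apply: le_trans (ler_norm _) _.
  by rewrite (bigD1 i) //= lerDl sumr_ge0.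
(* The mesh 2r/(m+1) is so small that each [u i] changes by at most [e] across a cell. *)
pose m := Num.bound (`|K| * (2 * r) / e).
have Km : `|K| * (2 * r / m.+1%:R) <= e.
  rewrite mulrA ler_pdivrMr ?ltr0n // -ler_pdivrMl // [_^-1 * _]mulrC.
  apply: le_trans (_ : m%:R <= _); last by rewrite ler_nat.
  apply/ltW/archi_boundP/divr_ge0; last exact: ltW.
  by rewrite !mulr_ge0 // ltW.
(* The discrete theorem quantifies over all natural coordinates; those beyond the last face are
   clamped to it, so that every point lies in the cube. *)
pose pt (p : 'I_n.+1 -> nat) i : R := - r + 2 * r / m.+1%:R * (minn (p i) m.+1)%:R.
have m0 : 0 < m.+1%:R :> R by rewrite ltr0n.
have step0 : 0 <= 2 * r / m.+1%:R by rewrite divr_ge0 ?ler0n // mulr_ge0 // ltW.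
have ptr p i : `|pt p i| <= r.
  rewrite ler_norml /pt lerDl mulr_ge0 ?ler0n //=.
  rewrite -subr_ge0.
  have -> : r - (- r + 2 * r / m.+1%:R * (minn (p i) m.+1)%:R) =
     2 * r / m.+1%:R * (m.+1%:R - (minn (p i) m.+1)%:R).
    by field; rewrite gt_eqF.
  by rewrite mulr_ge0 // subr_ge0 ler_nat geq_minr.
pose h i p := 0 < u i (pt p).
have [||v hv] := @discrete_poincare_miranda n m h.
- move=> i p pi; rewrite /h -leNgt; apply: um => //.
  by rewrite /pt pi min0n mulr0 addr0.
- move=> i p pi; rewrite /h; apply: up => //.
  by rewrite /pt pi minnn; field; rewrite gt_eqF.
exists (pt (fun i => v i)) => // i.
have near p : (forall l, (v l <= p l <= v l + 1)%N) ->
    `|u i (pt (fun i => v i)) - u i (pt p)| <= e.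
  move=> vp; apply: le_trans Km; apply: le_trans (uK _ _ _ (2 * r / m.+1%:R) _) _.
    move=> j; have := vp j; have := ltn_ord (v j); rewrite /pt => vm /andP[vp1 vp2].
    rewrite !(minn_idPl _) ?(ltnW vm) //; last by lia.
    rewrite opprD addrACA subrr add0r -mulrBr normrM (ger0_norm step0).
    rewrite ler_piMr // distrC -natrB // ger0_norm // -[1]/(1%:R) ler_nat.
    by lia.
  by apply: ler_wpM2r; last exact: ler_norm.
have [p [q [hp hq vp vq]]] := hv i; rewrite /h -leNgt in hp hq.
have := near _ vp; have := near _ vq; rewrite !ler_norml => /andP[_ a] /andP[b _].
by apply/andP; split; [move: b hp|move: a hq]; lra.
Qed.
End Lipschitz.

(** * Invertible tuples are uniformly bounded away from zero *)

Section Unimodular.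
Variable R : realType.

(** A case of Cauchy-Schwarz, by summing the tangent line inequalities of the square at the average
    [s / n.+1]. *)
Lemma sqr_sum_le n (v : 'I_n.+1 -> R) (s : R) : 0 < s -> s <= \sum_j v j ->
  s ^+ 2 / n.+1%:R <= \sum_j v j ^+ 2.
Proof.
move=> s0 sv; have n0 : 0 < n.+1%:R :> R by rewrite ltr0n.
pose d := s / n.+1%:R.
have : \sum_j (2 * d * v j - d ^+ 2) <= \sum_j v j ^+ 2.
  apply: ler_sum => j _; rewrite -subr_ge0.
  have -> : v j ^+ 2 - (2 * d * v j - d ^+ 2) = (v j - d) ^+ 2 by ring.
  exact: sqr_ge0.
apply: le_trans; rewrite sumrB -mulr_sumr sumr_const card_ord -[_ ^+ 2 *+ _]mulr_natr.
have -> : s ^+ 2 / n.+1%:R = 2 * d * s - d ^+ 2 * n.+1%:R.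
  by rewrite /d; field; rewrite gt_eqF.
by rewrite lerD2r ler_wpM2l // mulr_ge0 // divr_ge0 // ltW.
Qed.

(** If the [x j] are bounded by K, the Bezout identity gives a sum of moduli at least 1/K. Errors
    adding up to at most 1/(2K) leave the sum at least 1/(2K), which allows passing to trigonometric
    polynomials. *)
Lemma unimodular_approx n (x u : 'I_n.+1 -> R -> R[i]) :
  (forall j, exists M : R, forall t, normc (x j t) <= M) ->
  (forall t, \sum_j x j t * u j t = 1) ->
  exists e c : R, [/\ 0 < e, 0 < c & forall v : 'I_n.+1 -> R -> R[i],
    (forall j t, normc (u j t - v j t) <= e) ->
    forall t, c <= \sum_j normc (v j t) ^+ 2].
Proof.
move=> /choice[M xM] xu1.
have [K K0 xK] : exists2 K : R, 0 < K & forall j t, normc (x j t) <= K.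
  exists (\sum_j `|M j| + 1) => [|j t]; first by rewrite ltr_wpDl // sumr_ge0.
  apply: le_trans (xM j t) _; apply: le_trans (ler_norm _) _.
  by rewrite (bigD1 j) //= -addrA lerDl addr_ge0 // sumr_ge0.
have n0 : 0 < n.+1%:R :> R by rewrite ltr0n.
pose s := K^-1 / 2; have s0 : 0 < s by rewrite divr_gt0 ?invr_gt0.
exists (s / n.+1%:R), (s ^+ 2 / n.+1%:R).
split=> [||v uv t]; first exact: divr_gt0.
  by apply: divr_gt0; first exact: exprn_gt0.
apply: (sqr_sum_le (v := fun j => normc (v j t))) => //.
have : 1 <= K * \sum_j normc (u j t).
  rewrite -(normc1 R) -(xu1 t); apply: le_trans (normc_sum _ _ _) _.
  rewrite mulr_sumr; apply: ler_sum => j _; rewrite normcM.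
  by apply: ler_wpM2r; [exact: normc_ge0|exact: xK].
rewrite -ler_pdivrMl // mulr1 => Ku.
have : \sum_j normc (u j t) <= \sum_j (s / n.+1%:R + normc (v j t)).
  by apply: ler_sum => j _; apply: le_trans (normc_triB _ (v j t)) _; rewrite lerD2r.
rewrite big_split sumr_const card_ord /= -[_ *+ n.+1]mulr_natr divfK ?gt_eqF //.
move/(le_trans Ku) => Kv; rewrite -(lerD2l s); apply: le_trans Kv.
by rewrite /s -splitr.
Qed.
End Unimodular.

(** * Almost zeros of complex maps on a cube *)

Section ComplexZeros.
Variables (R : realType) (n : nat).
Local Notation N := (n.+1 + n.+1)%N.

(** On the faces of [-pi/2, pi/2]^N the sine of the corresponding coordinate is 1 or -1, and an
    error less than 1 preserves its sign: Poincare-Miranda applies to the real and imaginary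
    parts. *)
Lemma complex_poincare_miranda (U : 'I_n.+1 -> ('I_N -> R) -> R[i]) (c : R) :
  0 < c ->
  (forall j, bounded_lipschitz (fun x => complex.Re (U j x))) ->
  (forall j, bounded_lipschitz (fun x => complex.Im (U j x))) ->
  (forall x, (exists i, `|sin (x i)| = 1) -> forall j,
    normc (U j x - (sin (x (lshift _ j)) +i* sin (x (rshift _ j)))) < 1) ->
  exists x, \sum_j normc (U j x) ^+ 2 < c.
Proof.
move=> c0 reU imU Ubd.
pose u (i : 'I_N) (x : 'I_N -> R) : R := match fintype.split i with
  | inl j => complex.Re (U j x) | inr j => complex.Im (U j x) end.
have ul i : bounded_lipschitz (u i).
  by rewrite /u; case: fintype.split => j; [exact: reU|exact: imU].
have usin i x : `|sin (x i)| = 1 -> `|u i x - sin (x i)| < 1.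
  move=> xi; have {xi} := Ubd _ (ex_intro _ i xi).
  rewrite /u => xU; rewrite -[X in sin (x X)]splitK.
  case: fintype.split => j /=; apply: le_lt_trans (xU j).
    by apply: le_trans (Re_le_normc _); rewrite Re_subc.
  by apply: le_trans (Im_le_normc _); rewrite Im_subc.
(* With [e] at most 1, components bounded by [e] have squares bounded by [e]; the 2(n+1) squares
   then add up to less than [c]. *)
pose e : R := Num.min 1 (c / (2 * n.+1%:R + 1)).
have k0 : 0 < 2 * n.+1%:R + 1 :> R by rewrite ltr_wpDl ?mulr_ge0.
have e0 : 0 < e by rewrite lt_min ltr01 divr_gt0.
have [|||x _ ux] := @poincare_miranda _ _ (pi / 2) u e _ e0 ul.
- by rewrite divr_gt0 ?pi_gt0.
- move=> i x _ xi; have := usin i x; rewrite xi sinN sin_pihalf normrN normr1.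
  by move=> /(_ erefl); rewrite ltr_norml => /andP[_]; lra.
- move=> i x _ xi; have := usin i x; rewrite xi sin_pihalf normr1.
  by move=> /(_ erefl); rewrite ltr_norml => /andP[+ _]; lra.
exists x; apply: le_lt_trans (_ : \sum_(j < n.+1) 2 * e < _).
  apply: ler_sum => j _; rewrite normcE2.
  have ee (y : R) : `|y| <= e -> y ^+ 2 <= e.
    move=> ye; rewrite -real_normK ?num_real // expr2.
    rewrite -[leRHS]mulr1; apply: ler_pM => //; apply: le_trans ye _.
    by rewrite ge_min lexx.
  rewrite mulr_natl mulr2n; apply: lerD; apply: ee.
    by have := ux (lshift n.+1 j); rewrite /u (unsplitK (inl _ j)).
  by have := ux (rshift n.+1 j); rewrite /u (unsplitK (inr _ j)).
rewrite sumr_const card_ord -[_ *+ n.+1]mulr_natr mulrAC.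
have : e * (2 * n.+1%:R + 1) <= c by rewrite -ler_pdivlMr // ge_min lexx orbT.
by rewrite mulrDr mulr1 mulrC; lra.
Qed.
End ComplexZeros.

(** * The obstruction to invertibility *)

Section TestFunctions.
Variable R : realType.
Implicit Types (T : seq (R[i] * R)).

Definition torus_char n (kappa : 'I_n -> R -> R) (x : 'I_n -> R) : R -> R :=
  fun l => \sum_i x i * kappa i l.

Lemma torus_charD n (kappa : 'I_n -> R -> R) x :
  (forall i, {morph kappa i : l m / l + m}) ->
  {morph torus_char kappa x : l m / l + m}.
Proof.
move=> kD l m; rewrite /torus_char -big_split; apply: eq_bigr => i _.
by rewrite kD mulrDr.
Qed.

Lemma bounded_lipschitz_Re n T (kappa : 'I_n.+1 -> R -> R) :
  bounded_lipschitz (fun x => complex.Re (tp_eval T (torus_char kappa x))).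
Proof.
elim: T => [|[c l] T IH].
  under eq_fun => x do rewrite /tp_eval big_nil.
  exact: bounded_lipschitz_cst.
under eq_fun => x do rewrite /tp_eval big_cons Re_addc Re_mulc -mulNr /=.
apply: bounded_lipschitzD IH; apply: bounded_lipschitzD;
  apply: bounded_lipschitzM; try exact: bounded_lipschitz_cst.
  exact: bounded_lipschitz_linear (@cos_max R) (@cos_lipschitz R).
exact: bounded_lipschitz_linear (@sin_max R) (@sin_lipschitz R).
Qed.

Lemma bounded_lipschitz_Im n T (kappa : 'I_n.+1 -> R -> R) :
  bounded_lipschitz (fun x => complex.Im (tp_eval T (torus_char kappa x))).
Proof.
rewrite (_ : (fun _ => _) =
    fun x => complex.Re (tp_eval (tp_scale (- 'i) T) (torus_char kappa x))).
  exact: bounded_lipschitz_Re.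
apply/funext => x; rewrite tp_eval_scale Re_mulc /=.
by rewrite oppr0 mul0r sub0r mulNr opprK mul1r.
Qed.

(** The opposite of a frequency may lie outside [Lambda], so the term e^(-ix) of the sine uses a
    second independent frequency, on which [kappa i] takes the opposite value. *)
Lemma exists_sine_coordinates (Lambda : set R) n : ~ Qfinite_dim (Qspan Lambda) ->
  exists (S : 'I_n -> seq (R[i] * R)) (kappa : 'I_n -> R -> R),
  [/\ forall i p, p \in S i -> Lambda p.2,
      forall i, {morph kappa i : x y / x + y} &
      forall x i, tp_eval (S i) (torus_char kappa x) = (sin (x i))%:C].
Proof.
move=> /(@dual_family _ _ (n + n))[lam [l [Llam lD ld]]].
exists (fun i => [:: (Complex 0 (- 2^-1), lam i); (Complex 0 2^-1, lam (n + i)%N)]),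
  (fun i x => l i x - l (n + i)%N x).
have nlt (i : 'I_n) : (i < n + n)%N by rewrite ltn_addr.
have nlt' (i : 'I_n) : (n + i < n + n)%N by rewrite ltn_add2l.
split=> [i p|i x y|x i].
- by rewrite !inE => /orP[] /eqP-> /=; exact: Llam.
- by rewrite !lD; ring.
have nij (a b : 'I_n) : (n + a == b)%N = false by have := ltn_ord b; lia.
have e1 : torus_char (fun (i : 'I_n) x => l i x - l (n + i)%N x) x (lam i) = x i.
  rewrite /torus_char (bigD1 i) //= big1 ?addr0 => [|j ji].
    by rewrite !ld // eqxx nij subr0 mulr1.
  by rewrite !ld // -val_eqE /= in ji *; rewrite (negbTE ji) nij subrr mulr0.
have e2 : torus_char (fun (i : 'I_n) x => l i x - l (n + i)%N x) x (lam (n + i)%N) = - x i.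
  rewrite /torus_char (bigD1 i) //= big1 ?addr0 => [|j ji].
    by rewrite !ld // eqxx eq_sym nij sub0r mulrN1.
  rewrite !ld // eqn_add2l -val_eqE /= in ji *.
  by rewrite (negbTE ji) eq_sym nij subrr mulr0.
rewrite /tp_eval !big_cons big_nil addr0 /= e1 e2 /expi cosN sinN.
apply/eqP; rewrite eq_complex /=.
by apply/andP; split; apply/eqP; field.
Qed.
End TestFunctions.

Section Obstruction.
Variables (R : realType) (Lambda : set R) (n : nat).
Local Notation N := (n.+1 + n.+1)%N.
Variables (S : 'I_N -> seq (R[i] * R)) (kappa : 'I_N -> R -> R).
Hypothesis Lambda_semigroup : subsemigroup Lambda.
Hypothesis S_Lambda : forall i p, p \in S i -> Lambda p.2.
Hypothesis kappaD : forall i, {morph kappa i : x y / x + y}.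
Hypothesis S_sin : forall x i, tp_eval (S i) (torus_char kappa x) = (sin (x i))%:C.

Let f (j : 'I_n.+1) := S (lshift _ j) ++ tp_scale 'i (S (rshift _ j)).
(** The conjugate of [f j] at the characters [torus_char kappa x], though not necessarily on the
    real line. Unlike [tp_conj], this keeps the frequencies in [Lambda]. *)
Let w (j : 'I_n.+1) := S (lshift _ j) ++ tp_scale (- 'i) (S (rshift _ j)).
Let g : seq (R[i] * R) := (1, 0) :: tp_scale (-1)
  (flatten [seq tp_mul (f j) (w j) | j <- enum 'I_n.+1]).

Let muleD (t : R) : {morph (fun l => l * t) : x y / x + y}.
Proof. by move=> x y; rewrite mulrDl. Qed.

Let f_Lambda j p : p \in f j -> Lambda p.2.
Proof.
by rewrite mem_cat => /orP[|/mapP[q + -> /=]]; exact: S_Lambda.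
Qed.

Let w_Lambda j p : p \in w j -> Lambda p.2.
Proof.
by rewrite mem_cat => /orP[|/mapP[q + -> /=]]; exact: S_Lambda.
Qed.

Let g_Lambda p : p \in g -> Lambda p.2.
Proof.
rewrite in_cons => /orP[/eqP-> /=|]; first by case: Lambda_semigroup.
case/mapP => q /flattenP[_ /mapP[j _ ->] /allpairsP[[a b] /= [fa wb ->]]] -> /=.
by apply: (proj2 Lambda_semigroup); [exact: f_Lambda fa|exact: w_Lambda wb].
Qed.

Let g_eval (L : R -> R) : {morph L : x y / x + y} ->
  tp_eval g L = 1 - \sum_j tp_eval (f j) L * tp_eval (w j) L.
Proof.
move=> LD; rewrite {1}/tp_eval big_cons -/(tp_eval _ L) /= morph0 // expi0 mulr1.
rewrite tp_eval_scale tp_eval_flatten big_enum mulN1r; congr (_ - _).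
by apply: eq_big => [j|j _]; rewrite ?inE // tp_eval_mul.
Qed.

Let f_sin j x : tp_eval (f j) (torus_char kappa x) =
  sin (x (lshift _ j)) +i* sin (x (rshift _ j)).
Proof.
rewrite tp_eval_cat tp_eval_scale !S_sin.
by apply/eqP; rewrite eq_complex /= !mul0r !mul1r subr0 !addr0 !add0r !eqxx.
Qed.

Let g_sin x : tp_eval g (torus_char kappa x) = (1 - \sum_i sin (x i) ^+ 2)%:C.
Proof.
rewrite g_eval; last exact: torus_charD.
rewrite rmorphB rmorph1 big_split_ord /= -big_split rmorph_sum; congr (_ - _).
apply: eq_bigr => j _; rewrite f_sin tp_eval_cat tp_eval_scale !S_sin.
by apply/eqP; rewrite eq_complex /=; apply/andP; split; apply/eqP; ring.
Qed.

Let normc_f x : \sum_j normc (tp_eval (f j) (torus_char kappa x)) ^+ 2 =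
  \sum_i sin (x i) ^+ 2.
Proof.
rewrite big_split_ord /= -big_split; apply: eq_bigr => j _.
by rewrite f_sin normcE2.
Qed.

(** A trigonometric approximation [Q] of an invertible [G] near [F] stays within 3/4 of [f] at all
    the characters, hence comes arbitrarily close to 0 there; this contradicts the lower bound
    carried over from the real line. *)
Lemma not_dense_unimodular : exists2 F, tuples (APin Lambda) n.+1 F &
  forall G, invertible_tuples (APin Lambda) n.+1 G ->
  ~ forall j, (supnorm (F j - G j)%R < (2^-1)%:E)%E.
Proof.
exists (fun j => tp_fun (f j)).
  by move=> j; apply: tp_fun_APin => p; exact: f_Lambda.
move=> G [GA [x xA xG1]] FG.
have xb j : exists M : R, forall t, normc (x j t) <= M.
  by have [[/Cb_bounded]] := xA j.
have xG t : \sum_j x j t * G j t = 1.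
  by have := congr1 (fun h => h t) xG1; rewrite fct_sumE.
have [e [c [e0 c0 Gc]]] := unimodular_approx xb xG.
(* The bound [e] preserves the lower bound [c], and 1/4 keeps the total error 1/2 + 1/4 below 1. *)
pose e' := Num.min e 4^-1.
have e'0 : 0 < e' by rewrite lt_min e0 invr_gt0 ltr0n.
have /choice[Q GQ] : forall j, exists T, forall t, normc (G j t - tp_fun T t) < e'.
  by move=> j; have [GAP _] := GA j; exact: AP_approx.
have Qc : forall t, c <= \sum_j normc (tp_fun (Q j) t) ^+ 2.
  apply: (Gc (fun j => tp_fun (Q j))) => j t; apply: le_trans (ltW (GQ j t)) _.
  by rewrite ge_min lexx.
have [|||y] := @complex_poincare_miranda R n
  (fun j y => tp_eval (Q j) (torus_char kappa y)) c c0.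
- by move=> j; exact: bounded_lipschitz_Re.
- by move=> j; exact: bounded_lipschitz_Im.
- move=> y _ j; rewrite -f_sin.
  pose T := Q j ++ tp_scale (-1) (f j).
  have TE L : tp_eval (Q j) L - tp_eval (f j) L = tp_eval T L.
    by rewrite (tp_eval_cat (Q j)) (tp_eval_scale (-1)) mulN1r.
  rewrite TE; apply: le_lt_trans (_ : 2^-1 + 4^-1 < 1); last by lra.
  apply: tp_eval_le_sup => [|t]; first exact: torus_charD.
  rewrite /tp_fun -TE -[_ - _](subrKA (G j t)) addrC; apply: le_trans (le_normcD _ _) _.
  apply: lerD; first by rewrite -normcN opprB ltW // (normc_lt_supnorm t (FG j)).
  rewrite -normcN opprB; apply: le_trans (ltW (GQ j t)) _.
  by rewrite ge_min lexx orbT.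
apply/negP; rewrite -leNgt.
by apply: sum_normc_sq_transfer Qc; exact: torus_charD.
Qed.

Lemma irreducible_unimodular : exists2 F : 'I_n.+2 -> R -> R[i],
  invertible_tuples (APin Lambda) n.+2 F & ~ reducible (APin Lambda) F.
Proof.
pose F (k : 'I_n.+2) := if unlift ord_max k is Some j then tp_fun (f j) else tp_fun g.
(* The coefficients of the Bezout identity: the sum of the products of [f j] and [w j], plus [g], is
   1 by the choice of [g]. *)
pose W (k : 'I_n.+2) := if unlift ord_max k is Some j then tp_fun (w j) else cst 1.
have widenE (j : 'I_n.+1) : widen_ord (leqnSn n.+1) j = lift ord_max j.
  by apply/val_inj; rewrite /= /bump leqNgt ltn_ord.
exists F.
  split=> [k|].
    rewrite /F; case: unlift => [j|]; apply: tp_fun_APin => p; first exact: f_Lambda.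
    exact: g_Lambda.
  exists W => [k|].
    rewrite /W; case: unlift => [j|]; first by apply: tp_fun_APin => p; exact: w_Lambda.
    rewrite (_ : cst 1 = tp_fun [:: (1, 0)]).
      apply: tp_fun_APin => p; rewrite inE => /eqP-> /=; by case: Lambda_semigroup.
    by apply/funext => t; rewrite /tp_fun /tp_eval big_seq1 mul0r expi0 mulr1.
  apply/funext => t; rewrite fct_sumE big_ord_recr /= /F /W unlift_none.
  rewrite [X in _ + X](_ : _ = tp_fun g t); last exact: mul1r.
  rewrite /tp_fun g_eval //; under eq_bigr => j _ do rewrite widenE liftK.
  rewrite [X in X + _](_ : _ = \sum_j tp_fun (f j) t * tp_fun (w j) t).
    by rewrite addrC subrK.
  by apply: eq_bigr => j _; rewrite mulrC.
case=> a aA [uA [x xA xu1]].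
have xb j : exists M : R, forall t, normc (x j t) <= M.
  by have [[/Cb_bounded]] := xA j.
pose u j t := tp_fun (f j) t + a j t * tp_fun g t.
have xu t : \sum_j x j t * u j t = 1.
  have := congr1 (fun h => h t) xu1; rewrite fct_sumE; apply: etrans.
  apply: eq_bigr => j _; congr (_ * _).
  by rewrite /u /F widenE liftK unlift_none.
have [e [c [e0 c0 uc]]] := unimodular_approx xb xu.
pose B : R := \sum_(p <- g) normc p.1.
have B0 : 0 <= B by apply: sumr_ge0 => p _; exact: normc_ge0.
(* Since [B] bounds |g|, replacing [a j] by [P j] changes [u j] by at most [e]. *)
have e'0 : 0 < e / (B + 1) by rewrite divr_gt0 // ltr_wpDl.
have /choice[P aP] : forall j, exists T, forall t, normc (a j t - tp_fun T t) < e / (B + 1).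
  by move=> j; have [aAP _] := aA j; exact: AP_approx.
pose V j := f j ++ tp_mul (P j) g.
have VE j L : {morph L : x y / x + y} ->
    tp_eval (V j) L = tp_eval (f j) L + tp_eval (P j) L * tp_eval g L.
  by move=> LD; rewrite (tp_eval_cat (f j)) tp_eval_mul.
have Vc : forall t, c <= \sum_j normc (tp_fun (V j) t) ^+ 2.
  apply: (uc (fun j => tp_fun (V j))) => j t.
  have -> : tp_fun (V j) t = tp_fun (f j) t + tp_fun (P j) t * tp_fun g t.
    exact: VE.
  rewrite /u opprD addrACA subrr add0r -mulrBl normcM.
  apply: le_trans (_ : e / (B + 1) * (B + 1) <= _); last first.
    by rewrite divfK // gt_eqF // ltr_wpDl.
  apply: ler_pM; rewrite ?normc_ge0 // ?(ltW (aP j t)) //.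
  by apply: le_trans (normc_tp_eval _ _) _; rewrite lerDl.
pose G y : R := 1 - \sum_(i < N) sin (y i) ^+ 2.
(* [G] is the value of [g] at the character. Its truncation vanishes as soon as some sine is 1 or
   -1, so that [U] agrees with the sines on the boundary of the cube. *)
pose U j y := tp_eval (f j) (torus_char kappa y) +
  tp_eval (P j) (torus_char kappa y) * (Num.max 0 (G y))%:C.
have lG : @bounded_lipschitz R _ (fun y => Num.max 0 (G y)).
  apply: bounded_lipschitz_max0; apply: bounded_lipschitzD.
    exact: bounded_lipschitz_cst.
  under eq_fun => y do rewrite -sumrN.
  apply: bounded_lipschitz_sum => i.
  under eq_fun => y do rewrite -mulN1r expr2.
  apply: bounded_lipschitzM; first exact: bounded_lipschitz_cst.
  by apply: bounded_lipschitzM; under eq_fun => y do rewrite -[sin _]/(complex.Re (sin (y i))%:C) -S_sin;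
    exact: bounded_lipschitz_Re.
have [||||y] := @complex_poincare_miranda R n U (Num.min c 1).
- by rewrite lt_min c0 ltr01.
- move=> j; under eq_fun => y do rewrite Re_addc Re_mulc /= mulr0 subr0.
  apply: bounded_lipschitzD; first exact: bounded_lipschitz_Re.
  by apply: bounded_lipschitzM lG; exact: bounded_lipschitz_Re.
- move=> j; under eq_fun => y do rewrite Im_addc Im_mulc /= mulr0 add0r.
  apply: bounded_lipschitzD; first exact: bounded_lipschitz_Im.
  by apply: bounded_lipschitzM lG; exact: bounded_lipschitz_Im.
- move=> y [i yi] j; rewrite /U f_sin (_ : Num.max 0 (G y) = 0).
    by rewrite mulr0 addr0 subrr normc0.
  apply/max_idPl; rewrite subr_le0 (bigD1 i) //= -real_normK ?num_real // yi.
  by rewrite expr1n lerDl sumr_ge0 // => k _; exact: sqr_ge0.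
(* Where [G] is nonnegative, [U] is the value of [V] and the bound [c] transfers; where it is
   negative, [U] is the vector of sines, whose squared norm 1 - G exceeds 1. *)
apply/negP; rewrite -leNgt ge_min /U; case: (leP 0 (G y)) => Gy.
  apply/orP; left.
  have yD : {morph torus_char kappa y : l m / l + m} by exact: torus_charD.
  under eq_bigr => j _ do rewrite -g_sin -(VE _ _ yD).
  exact: sum_normc_sq_transfer Vc.
apply/orP; right; under eq_bigr => j _ do rewrite mulr0 addr0.
by rewrite normc_f -subr_le0 ltW.
Qed.
End Obstruction.

(** * Both stable ranks are infinite *)

Lemma least_pos_infty (P : nat -> Prop) :
  (forall n, (0 < n)%N -> ~ P n) -> least_pos P = +oo%E.
Proof.
move=> nP; rewrite /least_pos; case: pselect => // h; exfalso; case: h => n /asboolP[n0 Pn].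
by case: (nP n n0).
Qed.

Theorem theorem3p5 (R : realType) (Lambda : set R)
    (Lambda_semigroup : subsemigroup Lambda)
    (Lambda_infinite_dim : ~ Qfinite_dim (Qspan Lambda)) :
  bsr (APin Lambda) = +oo%E /\ tsr (APin Lambda) = +oo%E.
Proof.
split; apply: least_pos_infty => -[//|n] _ nP;
  have [S [kappa [SL kD Ssin]]] :=
    exists_sine_coordinates (n.+1 + n.+1) Lambda_infinite_dim.
- have [F Funi Firr] := irreducible_unimodular Lambda_semigroup SL kD Ssin.
  exact: Firr (nP F Funi).
- have [F FA Fnd] := not_dense_unimodular SL kD Ssin.
  have [|G GA FG] := nP F FA 2^-1; first by rewrite invr_gt0.
  exact: Fnd GA FG.
Qed.
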